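(* Let $\mathcal I$ be a flat ideal of subsets of $\omega$. The following are equivalent: (i) $\mathcal I$ is gradually flat; (ii) $\mathcal I\le_T\mathcal Z_0$; (iii) $\mathcal I\le_T l_1$; (iv) $\mathcal I\not\equiv_T[\mathfrak c]^{<\omega}$; (v) $\mathcal I$ is Fremlin; (vi) $\mathcal I$ is $\sigma$-weakly bounded; (vii) $\omega^\omega\not\le_T\mathcal I$.
   Context: A submeasure is a map $\varphi\colon\mathcal P(\omega)\to[0,\infty]$ with $\varphi(\emptyset)=0$, monotone and subadditive; lower semicontinuous (lsc) means $\varphi(a)=\lim_n\varphi(a\cap[0,n])$. $\mathrm{Fin}(\varphi)=\{a:\varphi(a)<\infty\}$. An lsc $\varphi$ is flat if for each $M>0$ there is $N>0$ such that for each finite $a$ with $\varphi(a)<N$ there is $j$ with: for all $b\subseteq\omega\setminus j$, $\varphi(b)<M\Rightarrow\varphi(a\cup b)<N$. It is gradual if for each $M>0$ there is $N>0$ such that for each $l$ there is $j$ such that for every family $B$ of at most $l$ subsets of $\omega\setminus j$, $\max_{b\in B}\varphi(b)<M\Rightarrow\varphi(\bigcup B)<N$. An ideal is flat (resp. gradually flat) if it is $\mathrm{Fin}(\varphi)$ for a flat (resp. flat and gradual) lsc $\varphi$. All ideals are ordered by inclusion. $l_1=\{A\subseteq\omega:\sum_{n\in A}\frac1{n+1}<\infty\}$, $\mathcal Z_0=\{A\subseteq\omega:\lim_n|A\cap n|/n=0\}$, $[\mathfrak c]^{<\omega}$ is the set of finite subsets of $2^\omega$ under inclusion, and $\omega^\omega$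 is ordered coordinatewise. $P\le_T Q$ means there is a map $P\to Q$ sending unbounded (from above) sets to unbounded sets; $\equiv_T$ means reducibility both ways. A subset $X$ of a partial order is weakly bounded if every infinite subset of $X$ contains an infinite bounded subset; a partial order is $\sigma$-weakly bounded if it is a countable union of weakly bounded sets. The game $\Gamma_1(\mathcal I)$: with $U_{-1}=\mathcal I$, at move $n$ Player I plays a countable family $\mathcal U_n$ with $\bigcup\mathcal U_n=U_{n-1}$; Player II plays $U_n\in\mathcal U_n$ and a sequence $(x^n_i)_{i\in\omega}$ in $U_n$; Player I plays an infinite $A_n\subseteq\omega$; Player II plays $m_n\in\omega$. Let $b_n=\bigcup\{x^n_i:i\in A_n\cap m_n\}$. Player I wins if $\bigcup_n b_n\in\mathcal I$, otherwise Player II wins. $\mathcal I$ is Fremlin if Player I has a winning strategy in $\Gamma_1(\mathcal I)$. *)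

(* Defs.v *)
From HB Require Import structures.
From mathcomp Require Import all_boot all_order all_algebra finmap.
From mathcomp Require Import all_classical all_reals all_analysis.

Set Implicit Arguments.
Unset Strict Implicit.
Unset Printing Implicit Defensive.

Import Order.TTheory GRing.Theory Num.Theory.
Import numFieldNormedType.Exports.

Local Open Scope classical_set_scope.
Local Open Scope ring_scope.

(* A natural number j is identified with {0, ..., j-1} = `I_j, so [0, n] is
   `I_n.+1 and omega \ j is ~` `I_j. *)

Section Submeasures.
Variable R : realType.
Implicit Types (phi : set nat -> \bar R) (I : set (set nat)).
Local Open Scope ereal_scope.

Record submeasure phi : Prop := Submeasure {
  submeasure_ge0 : forall a, 0 <= phi a ;
  submeasure0 : phi set0 = 0 ;
  submeasure_le : forall a b, a `<=` b -> phi a <= phi b ;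
  submeasureU : forall a b, phi (a `|` b) <= phi a + phi b }.

Definition lsc phi := forall a, phi (a `&` `I_n.+1) @[n --> \oo] --> phi a.

Definition Fin phi : set (set nat) := [set a | phi a < +oo].

Definition flat phi := forall M : R, (0 < M)%R -> exists2 N : R, (0 < N)%R &
  forall a, finite_set a -> phi a < N%:E ->
    exists j : nat, forall b, b `<=` ~` `I_j ->
      phi b < M%:E -> phi (a `|` b) < N%:E.

Definition gradual phi := forall M : R, (0 < M)%R -> exists2 N : R, (0 < N)%R &
  forall l : nat, exists j : nat, forall B : set (set nat),
    (B #<= `I_l)%card -> (forall b, B b -> b `<=` ~` `I_j) ->
    (forall b, B b -> phi b < M%:E) -> phi (\bigcup_(b in B) b) < N%:E.

(* [Fin phi] is automatically an ideal when [phi] is a submeasure. *)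
Definition flat_ideal I := exists phi,
  [/\ submeasure phi, lsc phi, flat phi & I = Fin phi].

Definition gradually_flat_ideal I := exists phi,
  [/\ submeasure phi, lsc phi, flat phi, gradual phi & I = Fin phi].

Definition l1 : set (set nat) :=
  [set A | \esum_(n in A) (n.+1%:R^-1 : R)%:E < +oo].

Definition Z0 : set (set nat) :=
  [set A | (#|` fset_set (A `&` `I_n)|%:R / n%:R)%R @[n --> \oo] --> (0 : R)%R].

End Submeasures.

(* A partial order is given as a subset [P] of a porderType, with the induced
   order; in particular bounds of subsets of [P] must lie in [P].  The library
   orders [set T] by inclusion and [nat -> nat] coordinatewise. *)
Section Orders.
Variables (d : Order.disp_t) (T : porderType d).

Definition bounded_in (P X : set T) := exists2 u, P u & ubound X u.

Definition weakly_bounded (P X : set T) :=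
  X `<=` P /\
  forall Y, Y `<=` X -> infinite_set Y ->
    exists Z, [/\ Z `<=` Y, infinite_set Z & bounded_in P Z].

Definition sigma_weakly_bounded (P : set T) := exists X : nat -> set T,
  P = \bigcup_n X n /\ forall n, weakly_bounded P (X n).

End Orders.

Definition tukey_le (d d' : Order.disp_t) (S : porderType d) (T : porderType d')
    (P : set S) (Q : set T) := exists f : S -> T, set_fun P Q f /\
  forall X, X `<=` P -> ~ bounded_in P X -> ~ bounded_in Q (f @` X).

Definition tukey_equiv (d d' : Order.disp_t) (S : porderType d)
    (T : porderType d') (P : set S) (Q : set T) :=
  tukey_le P Q /\ tukey_le Q P.

Definition fin_continuum : set (set (nat -> bool)) := [set F | finite_set F].

Definition baire : set (nat -> nat) := setT.

Section Game.
Variable I : set (set nat).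

(* Player II's moves in one round: U_n, (x^n_i)_i and m_n. *)
Record moveII := MoveII {
  mvU : set (set nat) ;
  mvx : nat -> set nat ;
  mvm : nat }.

(* The sequence argument lists Player II's moves in the completed rounds; the
   family U_n and the sequence (x^n_i)_i of the current round are known to
   Player I when choosing A_n. *)
Record strategyI := StrategyI {
  playU : seq moveII -> set (set (set nat)) ;
  playA : seq moveII -> set (set nat) -> (nat -> set nat) -> set nat }.

Implicit Types (s : strategyI) (r : nat -> moveII).

Definition famI s r n := playU s (mkseq r n).

Definition infI s r n := playA s (mkseq r n) (mvU (r n)) (mvx (r n)).

Definition prevU r n := if n is k.+1 then mvU (r k) else I.

Definition legalII s r n :=
  famI s r n (mvU (r n)) /\ forall i, mvU (r n) (mvx (r n) i).

(* Player I's moves have to obey the rules in every position reached by legal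
   moves of Player II. *)
Definition legalI s := forall r n, (forall k, (k < n)%N -> legalII s r k) ->
  [/\ countable (famI s r n),
      \bigcup_(U in famI s r n) U = prevU r n &
      legalII s r n -> infinite_set (infI s r n)].

Definition outcome s r n :=
  \bigcup_(i in infI s r n `&` `I_(mvm (r n))) mvx (r n) i.

Definition winningI s := legalI s /\
  forall r, (forall n, legalII s r n) -> I (\bigcup_n outcome s r n).

Definition Fremlin := exists s, winningI s.

End Game.

(* Main.v *)
(* For a flat and gradual submeasure phi there are fast growing blocks of omega
   such that a family X of sets of uniformly bounded submeasure has its union in
   Fin(phi) as soon as, for almost all k, X leaves at most l k traces on the
   first k blocks: by graduality the union has bounded submeasure on each block,
   and flatness glues the even blocks and the odd blocks. Coding the traces by
   finite sets of small weight, l k of which have a large union, gives Tukey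
   maps to l_1 and Z_0 (where these sets have to be independent rather than
   disjoint); Player I wins by making traces constant and sequences convergent.

   In l_1 and Z_0 every uncountable family has an infinite bounded subfamily, so
   [c]^{<omega} does not reduce to them. Conversely, if phi is flat but not
   gradual, blocks carry boundedly many sets of bounded submeasure with unions
   of large submeasure; letting each point of 2^omega choose one set per block,
   with all finite patterns of choices occurring, flatness puts the resulting
   sets in Fin(phi) while every infinite union of them is outside, hence
   [c]^{<omega} reduces to Fin(phi), and so does omega^omega. Finally, if the
   ideal is not sigma-weakly bounded then Player II can keep a family with this
   property and choose b_n of submeasure at least n. *)

Require Import Defs.
From mathcomp Require Import all_boot all_order all_algebra finmap.
From mathcomp Require Import all_classical all_reals all_analysis.

Set Implicit Arguments.
Unset Strict Implicit.
Unset Printing Implicit Defensive.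

Import Order.TTheory GRing.Theory Num.Theory.
Import numFieldNormedType.Exports.

Local Open Scope classical_set_scope.
Local Open Scope ring_scope.

(** * Diagonal sequences and Tukey maps *)

Lemma infinite_sets_distinct (T : eqType) (C : nat -> set T) :
  (forall k, infinite_set (C k)) ->
  exists2 a : nat -> T, injective a & forall k, C k (a k).
Proof.
move=> Cinf.
have /choice[f fP] (ks : nat * seq T) : exists x, C ks.1 x /\ x \notin ks.2.
  apply: contrapT => /forallNP noelt; apply: (Cinf ks.1).
  apply: sub_finite_set (finite_seq ks.2) => x Cx /=.
  by apply: contrapT => /negP xs; apply: (noelt x).
pose s := fix s k := if k is k'.+1 then rcons (s k') (f (k', s k')) else [::].
pose a k := f (k, s k).
have as_ i k : (i < k)%N -> a i \in s k.
  elim: k => // k IH; rewrite ltnS leq_eqVlt /= mem_rcons inE.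
  by case/predU1P => [->|/IH ->]; rewrite ?eqxx ?orbT.
have a_neq i k : (i < k)%N -> a i <> a k.
  by move=> /as_ ai e; have := (fP (k, s k)).2; rewrite /= -/(a k) -e ai.
exists a => [i k e|k]; last exact: (fP (k, s k)).1.
case: (ltngtP i k) => // ik; last by have := a_neq _ _ ik; rewrite e.
by have := a_neq _ _ ik.
Qed.

(* [big] is infinitude for sequences and uncountability for families indexed by
   the Cantor space. *)
Lemma diagonal_subsequence (T : eqType) (V : Type) (big : set T -> Prop)
    (h : nat -> T -> V) :
  (forall A, big A -> infinite_set A) -> big setT ->
  (forall k A, big A ->
    exists B, [/\ B `<=` A, big B & forall x y, B x -> B y -> h k x = h k y]) ->
  exists2 a : nat -> T, injective a &
    forall k i, (k <= i)%N -> h k (a i) = h k (a k).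
Proof.
move=> big_inf bigT shrink.
have /choice[F FP] (kA : nat * set T) : exists B, big kA.2 ->
    [/\ B `<=` kA.2, big B & forall x y, B x -> B y -> h kA.1 x = h kA.1 y].
  have [bA|nbA] := pselect (big kA.2); last by exists set0.
  by have [B ?] := shrink kA.1 _ bA; exists B.
(* The sets [C k] decrease and [h k] is constant on [C k], so distinct points [a k] chosen in [C k]
   form the required diagonal sequence. *)
pose C := fix C k := F (k, if k is k'.+1 then C k' else setT).
have bigC k : big (C k).
  elim: k => [|k IH]; first by have [] := FP (0%N, setT) bigT.
  by have [] := FP (k.+1, C k) IH.
have Cconst k x y : C k x -> C k y -> h k x = h k y.
  case: k => [|k]; first by have [_ _] := FP (0%N, setT) bigT; apply.
  by have [_ _] := FP (k.+1, C k) (bigC k); apply.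
have Csub k i : (k <= i)%N -> C i `<=` C k.
  elim: i => [|i IH]; first by rewrite leqn0 => /eqP ->.
  rewrite leq_eqVlt => /predU1P[->//|]; rewrite ltnS => /IH; apply: subset_trans.
  by have [] := FP (i.+1, C i) (bigC i).
have [a a_inj aC] := infinite_sets_distinct (fun k => big_inf _ (bigC k)).
exists a => // k i ki; apply: Cconst; last exact: aC.
exact: Csub ki _ (aC i).
Qed.

Lemma infinite_pigeonhole (T : Type) (h : T -> nat) (e : nat) (A : set T) :
  (forall x, h x < e)%N -> infinite_set A ->
  exists v, infinite_set (A `&` h @^-1` [set v]).
Proof.
move=> he Ainf; apply: contrapT => /forallNP fin; apply: Ainf.
have -> : A = \bigcup_(v in `I_e) (A `&` h @^-1` [set v]).
  apply/seteqP; split=> [x Ax|x [v _ []]//]; by exists (h x); first exact: he.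
apply: bigcup_finite; first exact: finite_II.
by move=> v _; have /contrapT := fin v.
Qed.

Lemma uncountable_pigeonhole (T : Type) (V : countType) (h : T -> V)
    (A : set T) : ~ countable A ->
  exists v, ~ countable (A `&` h @^-1` [set v]).
Proof.
move=> Aunc; apply: contrapT => /forallNP cnt; apply: Aunc.
have -> : A = \bigcup_(v in setT) (A `&` h @^-1` [set v]).
  apply/seteqP; split=> [x Ax|x [v _ []]//]; by exists (h x).
apply: bigcup_countable; first exact: countableP.
by move=> v _; have /contrapT := cnt v.
Qed.

Lemma infinite_range (T : Type) (a : nat -> T) :
  injective a -> infinite_set (range a).
Proof.
move=> a_inj /(finite_preimage (in2W a_inj)).
by rewrite preimage_range => /infinite_nat.
Qed.

Lemma uncountable_cantor_space : ~ countable [set: nat -> bool].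
Proof.
move=> /countable_injP[f /(_ _ _ (in_setT _) (in_setT _)) f_inj].
pose d n := `[< exists2 x, f x = n & x n = false >].
have /negP[] : ~~ d (f d).
  by apply/negP => dt; have /asboolP[x /f_inj ->] := dt; rewrite dt.
apply/asboolP; exists d => //; apply/negP => dt.
by have /asboolP[x /f_inj ->] := dt; rewrite dt.
Qed.

Lemma convergent_subsequence (h : nat -> nat -> nat) (e : nat -> nat) :
  (forall k i, h k i < e k)%N ->
  exists2 a : nat -> nat, injective a &
    forall k i, (k <= i)%N -> h k (a i) = h k (a k).
Proof.
move=> he; apply: (@diagonal_subsequence _ _ (fun A => infinite_set A)) => //.
  exact: infinite_nat.
move=> k A /(infinite_pigeonhole (he k))[v vinf].
exists (A `&` h k @^-1` [set v]); split=> //.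
by move=> x y [_ /= ->] [_ /= ->].
Qed.

Lemma uncountable_diagonal (V : countType) (h : nat -> (nat -> bool) -> V) :
  exists2 a : nat -> nat -> bool, injective a &
    forall k i, (k <= i)%N -> h k (a i) = h k (a k).
Proof.
apply: (@diagonal_subsequence _ _ (fun A => ~ countable A)).
- by move=> A Aunc /finite_set_countable.
- exact: uncountable_cantor_space.
move=> k A /(uncountable_pigeonhole (h k))[v vunc].
exists (A `&` h k @^-1` [set v]); split=> //.
by move=> x y [_ /= ->] [_ /= ->].
Qed.

(** The contrapositive form, in which all reductions below are built and used. *)
Lemma tukey_leP (d d' : Order.disp_t) (S : porderType d) (T : porderType d')
    (P : set S) (Q : set T) :
  (exists2 f : S -> T, set_fun P Q f &
    forall X, X `<=` P -> bounded_in Q (f @` X) -> bounded_in P X) <->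
  tukey_le P Q.
Proof.
split=> [[f fPQ fb]|[f [fPQ fb]]]; exists f => //.
  by split=> // X XP nb /(fb _ XP).
by move=> X XP bf; apply: contrapT => /(fb _ XP).
Qed.

Lemma tukey_le_trans (d d' d'' : Order.disp_t) (S : porderType d)
    (T : porderType d') (U : porderType d'') (P : set S) (Q : set T)
    (L : set U) : tukey_le P Q -> tukey_le Q L -> tukey_le P L.
Proof.
move=> /tukey_leP[f fPQ fb] /tukey_leP[g gQL gb]; apply/tukey_leP.
exists (g \o f) => [x Px|X XP]; first exact/gQL/fPQ.
rewrite -image_comp => bgf; apply: fb => //; apply: gb => //.
by move=> _ [x /XP Px <-]; apply: fPQ.
Qed.

Lemma bounded_in_bigcup (I : set (set nat)) (X : set (set nat)) :
  (forall a b, a `<=` b -> I b -> I a) ->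
  bounded_in I X <-> I (\bigcup_(x in X) x).
Proof.
move=> Isub; split=> [[u Iu uX]|IX]; last first.
  by exists (\bigcup_(x in X) x) => // x Xx; apply/subsetPset/bigcup_sup.
by apply: Isub Iu => p [x /uX /subsetPset]; apply.
Qed.

Lemma bounded_in_fin_continuum (X : set (set (nat -> bool))) :
  bounded_in fin_continuum X <-> finite_set (\bigcup_(F in X) F).
Proof.
split=> [[u uf uX]|fX]; last first.
  by exists (\bigcup_(x in X) x) => // x Xx; apply/subsetPset/bigcup_sup.
by apply: sub_finite_set uf => p [x /uX /subsetPset]; apply.
Qed.

(** One index per point below [m] is enough. Together with lower semicontinuity this reduces
    infinite unions to finite ones. *)
Lemma bigcup_initial_segment (s : nat -> set nat) (m : nat) :
  exists n, (\bigcup_r s r) `&` `I_m `<=` \bigcup_(r in `I_n) s r.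
Proof.
have /choice[f fP] (i : nat) : exists r, (\bigcup_r s r) i -> s r i.
  by have [[r _ ri]|ni] := pselect ((\bigcup_r s r) i); [exists r|exists 0%N].
exists (\max_(i < m) f i).+1 => i [/fP fi im].
by exists (f i) => //=; rewrite ltnS (leq_bigmax (Ordinal im)).
Qed.

(** * Tail ideals of weights *)

Section TailIdeals.
Variables (R : realType) (w : nat -> nat -> R).
Hypothesis w_ge0 : forall m i, 0 <= w m i.
Implicit Types a b : set nat.

(** Each [wsum m] is a measure living on [I_m]. Their supremum is a lower semicontinuous submeasure
    with exhaustive ideal [tail_ideal], a common form of $l_1$ and $\mathcal Z_0$. *)
Definition wsum m a : R := \sum_(i < m | `[< a i >]) w m i.

Definition small k a := forall m, wsum m a <= 2 ^- k.

Definition tail_ideal : set (set nat) :=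
  [set a | forall k, exists n, small k (a `\` `I_n)].

Lemma wsum_le m a b : a `<=` b -> wsum m a <= wsum m b.
Proof.
move=> ab; rewrite /wsum [leRHS](bigID (fun i : 'I_m => `[< a i >])) /=.
rewrite (eq_bigl (fun i : 'I_m => `[< b i >] && `[< a i >])); last first.
  move=> i; apply/asboolP/andP => [ai|[_ /asboolP]//].
  by split; apply/asboolP => //; apply: ab.
by rewrite lerDl sumr_ge0.
Qed.

Lemma wsum_initial_segment m n a : (m <= n)%N -> wsum m (a `&` `I_n) = wsum m a.
Proof.
move=> mn; apply: eq_bigl => i; apply/asboolP/asboolP => [[]//|ai]; split=> //.
exact: leq_trans (ltn_ord i) mn.
Qed.

Lemma wsumU m a b : wsum m (a `|` b) <= wsum m a + wsum m b.
Proof.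
rewrite /wsum big_mkcond [X in _ <= X + _]big_mkcond [X in _ <= _ + X]big_mkcond.
rewrite -big_split /=; apply: ler_sum => i _.
case: (asboolP (a i)) => ai; case: (asboolP (b i)) => bi;
  case: asboolP => abi; rewrite ?addr0 ?add0r ?lerDl ?addr_ge0 //.
by case: abi.
Qed.

Lemma wsum0 m : wsum m set0 = 0.
Proof. by rewrite /wsum big_pred0 // => i; apply/asboolP. Qed.

Lemma small0 k : small k set0.
Proof. by move=> m; rewrite wsum0 invr_ge0 exprn_ge0. Qed.

Lemma sub_small k a b : a `<=` b -> small k b -> small k a.
Proof. by move=> ab sb m; apply: le_trans (sb m); apply: wsum_le. Qed.

Lemma small_le k l a : (l <= k)%N -> small k a -> small l a.
Proof.
move=> lk sa m; apply: le_trans (sa m) _.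
by rewrite lef_pV2 ?posrE ?exprn_gt0 // ler_weXn2l // ler1n.
Qed.

Lemma half_powD k : 2 ^- k.+1 + 2 ^- k.+1 = 2 ^- k :> R.
Proof. by rewrite [RHS]splitr exprS invfM [_^-1 * _]mulrC. Qed.

Lemma smallU k a b : small k.+1 a -> small k.+1 b -> small k (a `|` b).
Proof.
move=> sa sb m; apply: le_trans (wsumU _ _ _) _.
by rewrite -half_powD lerD.
Qed.

(** A geometric series: the first [N'] sets weigh at most [2 ^- k - 2 ^- (k + N')], and finitely
    many sets cover the part of the union below [m]. *)
Lemma small_bigcup k (s : nat -> set nat) :
  (forall r, small (k + r.+1) (s r)) -> small k (\bigcup_r s r).
Proof.
move=> ss m; have [N NP] := bigcup_initial_segment s m.
have sub N' : wsum m (\bigcup_(r in `I_N') s r) <= 2 ^- k - 2 ^- (k + N').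
  elim: N' => [|N' IH].
    by rewrite II0 bigcup_set0 wsum0 addn0 subrr.
  rewrite IIS bigcup_setU bigcup_set1; apply: le_trans (wsumU _ _ _) _.
  apply: le_trans (lerD IH (ss N' m)) _.
  rewrite -[in X in X <= _](half_powD (k + N')) !addnS.
  by rewrite opprD addrA subrK.
apply: le_trans (_ : wsum m (\bigcup_(r in `I_N) s r) <= _); last first.
  by apply: le_trans (sub N) _; rewrite gerBl invr_ge0 exprn_ge0.
rewrite -[in leLHS](wsum_initial_segment _ (leqnn m)).
exact: wsum_le NP.
Qed.

Lemma tail_idealU a b : tail_ideal a -> tail_ideal b -> tail_ideal (a `|` b).
Proof.
move=> aJ bJ k; have [n an] := aJ k.+1; have [m bm] := bJ k.+1.
exists (maxn n m); apply: sub_small (smallU an bm) => i [abi /negP].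
rewrite -leqNgt geq_max => /andP[ni mi].
by case: abi => [ai|bi]; [left|right]; split=> //=; apply/negP; rewrite -leqNgt.
Qed.

Lemma finite_tail_ideal n a : a `<=` `I_n -> tail_ideal a.
Proof.
move=> an k; exists n; apply: (sub_small _ (small0 k)) => i [/an].
by move=> ? [].
Qed.

(** Let [n (k, c)] be a cut beyond which [x c] is small. Cuts and traces below them take countably
    many values, so there are distinct [a i] whose cuts and traces at level [k] agree for all
    [i >= k]. *)
Lemma tail_ideal_uncountable (x : (nat -> bool) -> set nat) :
  (forall c, tail_ideal (x c)) ->
  exists2 a : nat -> nat -> bool, injective a &
    tail_ideal (\bigcup_i x (a i)).
Proof.
move=> xJ.
have /choice[n nP] (kc : nat * (nat -> bool)) :
    exists n, small kc.1.+2 (x kc.2 `\` `I_n) := xJ kc.2 kc.1.+2.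
pose trace k c := [seq `[< x c i >] | i <- iota 0 (n (k, c))].
have [a a_inj aP] := uncountable_diagonal (fun k c => (n (k, c), trace k c)).
exists a => // k.
have nE r i : (r <= i)%N -> n (r, a i) = n (r, a r) by move=> /aP[].
have xE r i p : (r <= i)%N -> (p < n (r, a r))%N ->
    x (a i) p -> x (a r) p.
  move=> ri pn; have [ne tE] := aP _ _ ri.
  have := congr1 (fun s => nth false s p) tE; rewrite /trace ne.
  rewrite !(nth_map 0%N) ?size_iota // nth_iota // add0n => e xp.
  by apply/asboolP; rewrite -e; apply/asboolP.
have headJ K : tail_ideal (\bigcup_(i in `I_K) x (a i)).
  elim: K => [|K IH].
    by rewrite II0 bigcup_set0; apply: (@finite_tail_ideal 0).
  by rewrite IIS bigcup_setU bigcup_set1; apply: tail_idealU.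
pose K := k.+2; have [m hm] := headJ K k.+1.
exists (maxn m (n (K, a K))).
(* For [i >= K], a point of [x (a i)] beyond the cut of level [i] falls into the first half.
   Otherwise let [r] be the least level whose cut exceeds the point: equality of traces puts the
   point into [x (a r)], beyond the cut of level [r - 1], hence into the second half. *)
pose s r := (x (a (K + r)%N) `\` `I_(n (K + r, a (K + r)))%N)
  `|` (x (a (K + r).+1) `\` `I_(n (K + r, a (K + r)))%N).
apply: (@sub_small _ _ ((\bigcup_(i in `I_K) x (a i) `\` `I_m) `|` \bigcup_r s r)).
  move=> p [[i _ xp] /negP]; rewrite -leqNgt geq_max => /andP[mp np].
  have [iK|Ki] := ltnP i K.
    by left; split; [exists i|move=> /=; apply/negP; rewrite -leqNgt].
  right; have [ip|pi] := leqP (n (i, a i)) p.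
    exists (i - K)%N => //; left; rewrite subnKC //; split => //.
    by move=> /=; apply/negP; rewrite -leqNgt.
  have ex : exists r, (K <= r)%N && (p < n (r, a r))%N by exists i; rewrite Ki.
  case: (ex_minnP ex) => r /andP[Kr pr] rmin.
  have {}Kr : (K < r)%N.
    by rewrite ltn_neqAle Kr andbT; apply: contraTneq pr => <-; rewrite -leqNgt.
  have r1 : (r.-1.+1 = r)%N by rewrite prednK // (leq_trans _ Kr).
  have Kr1 : (K <= r.-1)%N by rewrite -ltnS r1.
  exists (r.-1 - K)%N => //; right; rewrite subnKC // r1; split.
    apply: (xE r i) => //; apply: rmin; by rewrite Ki.
  move=> /= pr1; have := rmin r.-1; rewrite Kr1 pr1 => /(_ isT).
  by rewrite -[X in (X <= _)%N]r1 ltnn.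
apply: smallU => //; apply: small_bigcup => r.
have snk i : (K + r <= i)%N ->
    small (K + r).+2 (x (a i) `\` `I_(n (K + r, a (K + r)))%N).
  by move=> ri; have := nP (K + r, a i)%N; rewrite (nE _ _ ri).
apply: small_le (smallU (snk _ (leqnn _)) (snk _ (leqnSn _))).
by rewrite /K !addSn !addnS leqnSn.
Qed.

(** Infinitely many singletons are never bounded in [fin_continuum], but for some infinite choice
    their images are bounded. *)
Lemma fin_continuum_not_le_tail_ideal : ~ tukey_le fin_continuum tail_ideal.
Proof.
move=> /tukey_leP[f fJ fb].
have [|a a_inj aJ] := @tail_ideal_uncountable (fun c => f [set c]).
  by move=> c; apply: fJ; apply: finite_set1.
have := fb (range (fun i => [set a i])) => /(_ _ _)/bounded_in_fin_continuum.
have sub : range (fun i => [set a i]) `<=` fin_continuum.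
  by move=> _ [i _ <-]; apply: finite_set1.
have bnd : bounded_in tail_ideal (f @` range (fun i => [set a i])).
  exists (\bigcup_i f [set a i]) => // _ [_ [i _ <-] <-].
  exact/subsetPset/bigcup_sup.
move=> /(_ sub bnd).
have -> : \bigcup_(F in range (fun i => [set a i])) F = range a.
  apply/seteqP; split=> [_ [_ [i _ <-] /= ->]|_ [i _ <-]]; first by exists i.
  by exists [set a i] => //; exists i.
exact: infinite_range.
Qed.

End TailIdeals.

(** * The ideals $l_1$ and $\mathcal Z_0$ as tail ideals *)

Lemma half_pow_small (R : realType) (e : R) : 0 < e ->
  exists k, 2 ^- k < e.
Proof.
move=> e0; have [k _ /(_ k (leqnn k))] := near_infty_natSinv_expn_lt (PosNum e0).
by rewrite /= div1r => ?; exists k.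
Qed.

Definition harmonic_weight (R : realType) (m i : nat) : R := i.+1%:R^-1.

Definition density_weight (R : realType) (m i : nat) : R := m%:R^-1.

Lemma wsum_split (R : realType) (w : nat -> nat -> R) :
  (forall m i, 0 <= w m i) -> forall m n (A : set nat),
  wsum w m A <= wsum w m (A `\` `I_n) + wsum w m `I_n.
Proof.
move=> w0 m n A; apply: le_trans (wsum_le w0 m _) (wsumU w0 m _ _) => i Ai.
have [ni|?] := leqP n i; last by right.
by left; split=> //=; apply/negP; rewrite -leqNgt.
Qed.

(** The tails of a finite nonnegative series tend to 0; conversely, one tail of sum at most 1
    already makes the series finite. *)
Lemma l1_tail_ideal (R : realType) : l1 R = tail_ideal (@harmonic_weight R).
Proof.
have w0 m i : 0 <= harmonic_weight R m i by rewrite invr_ge0.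
apply/seteqP; split=> A.
- rewrite /l1 /=; pose P n := `[< A n >].
  have AP : A = [set n | P n] by apply/seteqP; split=> n /asboolP.
  rewrite [X in \esum_(_ in X) _]AP -nneseries_esum; last first.
    by move=> n _; rewrite lee_fin invr_ge0.
  move=> sfin k; have tail : (\sum_(N <= i <oo | P i) (i.+1%:R^-1 : R)%:E
      @[N --> \oo] --> 0)%E.
    by apply: nneseries_tail_cvg sfin _ => n _; rewrite lee_fin invr_ge0.
  have [|n _ nP] := tail _ (@open_ereal_lt' _ 0%E (2 ^- k)%:E _).
    by rewrite lte_fin invr_gt0 exprn_gt0.
  exists n => m; rewrite -lee_fin; apply: le_trans (ltW (nP n (leqnn n))).
  apply: le_trans (nneseries_lim_ge m _); last first.
    by move=> i _ _; rewrite lee_fin invr_ge0.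
  rewrite sumEFin lee_fin (big_nat_widenl _ 0) // big_mkord /wsum.
  rewrite le_eqVlt; apply/orP; left; apply/eqP/eq_bigl => i.
  rewrite leqNgt; apply/asboolP/andP => [[Ai /negP ni]|[/asboolP Ai /negP ni]] //.
  by split=> //; apply/asboolP.
- move=> AJ; have [n An] := AJ 0%N.
  rewrite /l1 /=; pose P n := `[< A n >].
  have AP : A = [set n | P n] by apply/seteqP; split=> i /asboolP.
  rewrite [X in \esum_(_ in X) _]AP -nneseries_esum; last first.
    by move=> i _; rewrite lee_fin invr_ge0.
  apply: le_lt_trans (ltry (1 + \sum_(i < n) harmonic_weight R n i)).
  apply: lime_le.
    by apply: is_cvg_nneseries => i _ _; rewrite lee_fin invr_ge0.
  apply: nearW => m; rewrite sumEFin lee_fin big_mkord.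
  apply: le_trans (wsum_split w0 m n A) (lerD _ _).
    by apply: le_trans (An m) _; rewrite expr0 invr1.
  rewrite /wsum -(big_mkord (fun i => `[< `I_n i >]) (harmonic_weight R m)).
  rewrite -[leRHS](big_mkord xpredT (harmonic_weight R n)).
  rewrite [leRHS](big_nat_widen _ _ (maxn m n)) ?leq_maxr //=.
  rewrite [leRHS](big_cat_nat (n := m)) ?leq_maxl //=.
  rewrite (eq_bigl (fun i => i < n)%N) ?lerDl ?sumr_ge0 // => i.
  exact/asboolP/idP.
Qed.

Lemma wsum_density (R : realType) m (A : set nat) :
  wsum (@density_weight R) m A = #|` fset_set (A `&` `I_m)|%:R / m%:R.
Proof.
rewrite /wsum /density_weight sumr_const -[LHS]mulr_natl; congr (_%:R * _).
rewrite (_ : fset_set _ = [fset val i | i in [pred i : 'I_m | `[< A i >]]]%fset).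
  by rewrite card_imfset //=; last exact: val_inj; rewrite -cardE.
apply/fsetP => i; rewrite in_fset_set; last exact/finite_setIr/finite_II.
apply/idP/imfsetP => /= [|[j /asboolP Aj ->]]; rewrite ?inE /=.
  by move=> [Ai im]; exists (Ordinal im) => //; apply/asboolP.
by split=> //; apply: ltn_ord.
Qed.

Lemma Z0_tail_ideal (R : realType) : Z0 R = tail_ideal (@density_weight R).
Proof.
have w0 m i : 0 <= density_weight R m i by rewrite invr_ge0.
rewrite /Z0; apply/seteqP; split=> A /=.
- move=> /cvgr0Pnorm_le cvg k.
  have [n _ nP] := cvg (2 ^- k) ltac:(by rewrite invr_gt0 exprn_gt0).
  exists n => m; have [mn|nm] := leqP n m.
    apply: le_trans (wsum_le w0 m (@subDsetl _ A _)) _.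
    by rewrite wsum_density; apply: le_trans (ler_norm _) (nP m _).
  rewrite /wsum big_pred0 ?invr_ge0 ?exprn_ge0 // => i.
  by apply/asboolP => -[_]; apply; apply: ltn_trans nm.
- move=> AJ; apply/cvgr0Pnorm_le => e e0.
  have [k ke] := half_pow_small e0.
  have [n An] := AJ k.+1.
  (* From here on the points below [n] contribute at most [n / m <= 2 ^- k.+1]; the successor keeps
     [m] positive. *)
  exists (n * 2 ^ k.+1).+1 => // m /= nm.
  rewrite -wsum_density ger0_norm; last by apply: sumr_ge0.
  apply: le_trans (ltW ke); rewrite -half_powD.
  apply: le_trans (wsum_split w0 m n A) (lerD (An m) _).
  rewrite wsum_density ler_pdivrMr ?ltr0n ?(leq_ltn_trans _ nm) //.
  rewrite mulrC ler_pdivlMr ?exprn_gt0 // -natrX -natrM ler_nat.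
  apply: leq_trans (ltnW nm); rewrite leq_mul2r; apply/orP; right.
  apply: leq_trans (_ : #|` fset_set `I_n| <= _)%N.
    rewrite fsubset_leq_card // -fset_set_sub //; exact: finite_setIl.
  rewrite fset_set_II card_imfset //=; last exact: val_inj.
  by rewrite -cardE card_ord.
Qed.

(** * Submeasures *)

Section SubmeasureTheory.
Variables (R : realType) (phi : set nat -> \bar R).
Hypotheses (phi_sub : submeasure phi) (phi_lsc : lsc phi).
Implicit Types a b x : set nat.
Local Open Scope ereal_scope.

Lemma sub_Fin a b : a `<=` b -> Fin phi b -> Fin phi a.
Proof. by move=> /(submeasure_le phi_sub) ab; apply: le_lt_trans. Qed.

Lemma Fin0 : Fin phi set0.
Proof. by rewrite /Fin /= (submeasure0 phi_sub). Qed.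

Lemma FinU a b : Fin phi a -> Fin phi b -> Fin phi (a `|` b).
Proof.
move=> fa fb; apply: le_lt_trans (submeasureU phi_sub _ _) _.
exact: lte_add_pinfty.
Qed.

Lemma Fin_bigcup_II (x : nat -> set nat) n :
  (forall i, Fin phi (x i)) -> Fin phi (\bigcup_(i in `I_n) x i).
Proof.
move=> fx; elim: n => [|n IH]; first by rewrite II0 bigcup_set0; apply: Fin0.
by rewrite IIS bigcup_setU bigcup_set1; apply: FinU.
Qed.

Lemma Fin_bigcup_finite (X : set (set nat)) :
  finite_set X -> X `<=` Fin phi -> Fin phi (\bigcup_(x in X) x).
Proof.
move=> /finite_seqP[s ->] sF; rewrite bigcup_seq big_seq.
by elim/big_ind: _ => //; [apply: Fin0|apply: FinU].
Qed.

Lemma Fin_lt_nat a : Fin phi a -> exists n : nat, phi a < n%:R%:E.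
Proof.
move=> Fa; have pa : phi a \is a fin_num.
  by rewrite ge0_fin_numE // (submeasure_ge0 phi_sub).
exists (Num.bound (fine (phi a))); rewrite -(fineK pa) lte_fin.
exact/archi_boundP/fine_ge0/(submeasure_ge0 phi_sub).
Qed.

Lemma lsc_le a C : (forall n, phi (a `&` `I_n) <= C) -> phi a <= C.
Proof. by move=> aC; apply: (cvge_le _ (@phi_lsc a)); apply: nearW. Qed.

Lemma lsc_gt a C : C < phi a -> exists n, C < phi (a `&` `I_n).
Proof.
move=> Ca; apply: contrapT => /forallNP no; move: Ca; apply/negP.
by rewrite -leNgt; apply: lsc_le => n; rewrite leNgt; apply/negP.
Qed.

(** Since [I_m] has only finitely many subsets, the maximum of their indices [j] from flatness
    depends on [m] alone. *)
Lemma flat_uniform (M : R) : flat phi -> (0 < M)%R ->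
  exists2 N : R, (0 < N)%R & exists J : nat -> nat, forall m a b,
    a `<=` `I_m -> b `<=` ~` `I_(J m) -> phi a < N%:E -> phi b < M%:E ->
    phi (a `|` b) < N%:E.
Proof.
move=> phi_flat /phi_flat[N N0 NP]; exists N => //.
have /choice[j jP] a : exists j, finite_set a -> phi a < N%:E -> forall b,
    b `<=` ~` `I_j -> phi b < M%:E -> phi (a `|` b) < N%:E.
  have [[fa pa]|nfa] := pselect (finite_set a /\ phi a < N%:E).
    by have [j ?] := NP a fa pa; exists j.
  by exists 0%N => fa pa; case: nfa.
pose toset m (s : {set 'I_m}) := [set i | exists2 o, o \in s & val o = i].
exists (fun m => \max_(s : {set 'I_m}) j (toset m s))%N => m a b am bJ pa pb.
apply: jP => //; first exact: sub_finite_set am (finite_II m).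
apply: subset_trans bJ _; apply: subsetC => i /= ij.
have -> // : (i < \max_(s : {set 'I_m}) j (toset m s))%N.
apply: leq_trans ij _.
suff {1}-> : a = toset m (finset (fun o : 'I_m => `[< a (val o) >])).
  exact: leq_bigmax.
apply/seteqP; split=> [p ap|p [z]]; last by rewrite inE => /asboolP ? <-.
by exists (Ordinal (am _ ap)) => //; rewrite inE; apply/asboolP.
Qed.

(** Starting from [phi set0 = 0 < N], flatness adds one block at a time while the submeasure stays
    below [N]; lower semicontinuity passes to the infinite union, at the price of a non-strict
    bound. *)
Lemma flat_blocks (M N : R) (J q : nat -> nat) (b : nat -> set nat) :
  (0 < N)%R ->
  (forall m a b, a `<=` `I_m -> b `<=` ~` `I_(J m) -> phi a < N%:E ->
    phi b < M%:E -> phi (a `|` b) < N%:E) ->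
  (forall i, q i <= q i.+1)%N ->
  (forall i, b i `<=` `I_(q i.+1)) -> (forall i, b i `<=` ~` `I_(J (q i))) ->
  (forall i, phi (b i) < M%:E) -> phi (\bigcup_i b i) <= N%:E.
Proof.
move=> N0 JP qS bq bJ bM; apply: lsc_le => m.
have [n /(submeasure_le phi_sub) /le_trans] := bigcup_initial_segment b m.
apply; apply: ltW.
suff [] : \bigcup_(r in `I_n) b r `<=` `I_(q n) /\
    phi (\bigcup_(r in `I_n) b r) < N%:E by [].
elim: n => [|n [subn ltn]].
  by rewrite II0 bigcup_set0 (submeasure0 phi_sub) lte_fin; split.
rewrite IIS bigcup_setU bigcup_set1; split; last exact: JP subn (@bJ n) ltn (bM n).
rewrite subUset; split; last exact: bq.
by apply: subset_trans subn _ => i /= /leq_trans; apply.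
Qed.

Lemma gradual_uniform (M : R) : gradual phi -> (0 < M)%R ->
  exists2 N : R, (0 < N)%R & exists G : nat -> nat, forall l B,
    (B #<= `I_l)%card -> (forall b, B b -> b `<=` ~` `I_(G l)) ->
    (forall b, B b -> phi b < M%:E) -> phi (\bigcup_(b in B) b) < N%:E.
Proof.
by move=> phi_gr /phi_gr[N N0 /choice[G GP]]; exists N => //; exists G.
Qed.

End SubmeasureTheory.

(** * Coding by traces on blocks *)

Lemma card_le_seq_image (T : Type) (S : set T) (g : nat -> T) (s : seq nat)
    (l : nat) :
  (size s <= l)%N -> S `<=` [set g v | v in [set` s]] -> (S #<= `I_l)%card.
Proof.
move=> sl Ss; apply: card_le_trans (_ : (`I_(size s) #<= `I_l)%card); last first.
  by rewrite card_le_II.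
apply: card_le_trans (card_image_le (fun i => g (nth 0%N s i)) `I_(size s)).
apply: subset_card_le => x /Ss[v /= vs <-]; exists (index v s).
  by rewrite /= index_mem.
by rewrite nth_index.
Qed.

Definition block (j : nat -> nat) k : set nat := `I_(j k.+1) `\` `I_(j k).

Lemma block_cover (j : nat -> nat) p : (forall k, j k < j k.+1)%N ->
  (j 0 <= p)%N -> exists k, block j k p.
Proof.
move=> jS jp; have jge k : (k <= j k)%N.
  by elim: k => // k IH; apply: leq_ltn_trans IH (jS k).
have ex : exists k, (p < j k.+1)%N by exists p; apply: jge.
case: (ex_minnP ex) => k pk kmin; exists k; split=> //=; apply/negP.
rewrite -leqNgt; case: k kmin {pk} => // k kmin; rewrite leqNgt; apply/negP.
by move=> /kmin; rewrite ltnn.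
Qed.

(* On every second block the sets of bounded submeasure are glued by flatness,
   each of them being bounded by graduality. *)
Lemma gradual_blocks (R : realType) (phi : set nat -> \bar R) (M : R) :
  submeasure phi -> lsc phi -> flat phi -> gradual phi -> 0 < M ->
  exists H : nat -> nat -> nat, forall (j l : nat -> nat) (y : set nat),
    (forall k, j k < j k.+1)%N ->
    (forall k, H (l k.+1) (j k) <= j k.+1)%N ->
    (forall k, exists B : set (set nat), [/\ (B #<= `I_(l k.+1))%card,
      forall b, B b -> b `<=` ~` `I_(j k.+1),
      forall b, B b -> (phi b < M%:E)%E &
      y `&` block j k.+1 = \bigcup_(b in B) b]) ->
    Fin phi (y `\` `I_(j 1%N)).
Proof.
move=> phi_sub phi_lsc phi_flat phi_gr M0.
have [N N0 [G GP]] := gradual_uniform phi_gr M0.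
have [N' N'0 [J JP]] := flat_uniform phi_flat N0.
(* [G] bounds [y] by [N] on a single block. [J] lets blocks of the same parity be glued, the block
   of the other parity between them providing the gap that flatness needs. *)
exists (fun l m => maxn (G l) (J m)) => j l y jS HP yB.
have jG k : (G (l k.+1) <= j k.+1)%N.
  exact: leq_trans (leq_maxl _ _) (HP k).
have jJ k : (J (j k) <= j k.+1)%N by exact: leq_trans (leq_maxr _ _) (HP k).
have setCI (m n : nat) : (m <= n)%N -> ~` `I_n `<=` ~` `I_m.
  by move=> mn; apply: subsetC => i /= /leq_trans; apply.
pose c k := y `&` block j k.+1.
have cN k : (phi (c k) < N%:E)%E.
  have [B [Bl Bj BM cB]] := yB k; rewrite /c cB; apply: GP Bl _ BM => b /Bj bj.
  exact: subset_trans bj (setCI _ _ (jG k)).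
have cI k : c k `<=` `I_(j k.+2) by move=> p [_ []].
have cJ k : c k `<=` ~` `I_(J (j k)).
  by apply: subset_trans (setCI _ _ (jJ k)) => p [_ []].
have glue (r : nat) : Fin phi (\bigcup_i c (i.*2 + r)%N).
  apply: le_lt_trans (ltry N').
  apply: (flat_blocks phi_sub phi_lsc (q := fun i => j (i.*2 + r)%N)) N'0 JP _ _ _ _.
  - move=> i; rewrite doubleS !addSn.
    exact: leq_trans (ltnW (jS _)) (ltnW (jS _)).
  - by move=> i; rewrite doubleS !addSn; apply: cI.
  - by move=> i; apply: cJ.
  - by move=> i; apply: cN.
apply: (sub_Fin phi_sub _ (FinU phi_sub (glue 0%N) (glue 1%N))) => p [yp /negP].
rewrite -leqNgt => jp; have [|k kp] := @block_cover (j \o succn) p _ jp.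
  by move=> k; apply: jS.
have ck : c k p by [].
rewrite -(odd_double_half k) addnC in ck.
by case: (odd k) ck => ck; [right|left]; exists k./2.
Qed.

(** One member of [X] for each point below [m] covers the trace, so the union may be replaced by a
    finite one. *)
Lemma Fin_bigcup_II_trace (R : realType) (phi : set nat -> \bar R)
    (X : set (set nat)) m : submeasure phi -> X `<=` Fin phi ->
  Fin phi ((\bigcup_(x in X) x) `&` `I_m).
Proof.
move=> phi_sub XF.
have /choice[f fP] p : exists x, Fin phi x /\ ((\bigcup_(x in X) x) p -> x p).
  have [[x Xx xp]|np] := pselect ((\bigcup_(x in X) x) p).
    by exists x; split=> //; apply: XF.
  by exists set0; split=> //; apply: Fin0.
apply: (sub_Fin phi_sub _ (Fin_bigcup_II phi_sub m (fun p => (fP p).1))).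
by move=> p [/(fP p).2 fp pm]; exists p.
Qed.

(* [t k x] encodes the trace of [x] on the first [k.+1] blocks of a fast
   growing sequence. *)
Lemma gradual_coding (R : realType) (phi : set nat -> \bar R) (l : nat -> nat) :
  submeasure phi -> lsc phi -> flat phi -> gradual phi ->
  exists (t : nat -> set nat -> nat) (e : nat -> nat),
    (forall k x, t k x < e k)%N /\
    forall (M k0 : nat) (X : set (set nat)),
      (forall x, X x -> (phi x < M%:R%:E)%E) ->
      (forall k, (k0 <= k)%N -> forall s : seq nat, uniq s ->
        (forall v, v \in s -> exists2 x, X x & t k x = v) ->
        (size s <= l k)%N) ->
      Fin phi (\bigcup_(x in X) x).
Proof.
move=> phi_sub phi_lsc phi_flat phi_gr.
have /choice[H HP] M :=
  gradual_blocks phi_sub phi_lsc phi_flat phi_gr (ltr0Sn R M).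
(* One sequence serves all bounds: the step from [j k] to [j k.+1] respects [H M] for every
   [M <= k], so for a given [M] the blocks are suitable from index [M] on. *)
pose j := fix j k := if k is k'.+1 then
  maxn (j k').+1 (\max_(M < k) H M (l k) (j k'))%N else 0%N.
have jS k : (j k < j k.+1)%N by apply: leq_maxl.
have jH M k : (M <= k)%N -> (H M (l k.+1) (j k) <= j k.+1)%N.
  move=> Mk; apply: leq_trans (leq_maxr _ _).
  by rewrite (leq_bigmax (Ordinal (Mk : (M < k.+1)%N))).
pose T k := {ffun 'I_(j k.+1) -> bool}.
pose tr k (x : set nat) : T k := [ffun i : 'I_(j k.+1) => `[< x (val i) >]].
have trP k x y : tr k x = tr k y -> x `&` block j k `<=` y `&` block j k.
  move=> /ffunP exy p [xp [pj pj']]; split=> //.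
  have := exy (Ordinal pj); rewrite !ffunE /= => e.
  by apply/asboolP; rewrite -e; apply/asboolP.
exists (fun k x => nat_of_ord (enum_rank (tr k x))), (fun k => #|{: T k}|).
split=> [k x|M k0 X XM Xl]; first exact: ltn_ord.
(* From [K] on, both the growth of the blocks and the bound on the number of traces are available;
   what lies before is a trace on an initial segment. *)
pose K := maxn k0 M; set y := \bigcup_(x in X) x.
have XF : X `<=` Fin phi by move=> x /XM /lt_trans; apply; apply: ltry.
pose jK k := j (K + k)%N.
suff yF : Fin phi (y `\` `I_(jK 1%N)).
  have hF := Fin_bigcup_II_trace (jK 1%N) phi_sub XF.
  apply: (sub_Fin phi_sub _ (FinU phi_sub yF hF)).
  by move=> p yp; have [?|?] := pselect (`I_(jK 1%N) p); [right|left].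
apply: (HP M jK (fun k => l (K + k)%N)) => [k|k|k].
- by rewrite /jK addnS.
- by rewrite /jK addnS; apply: jH; rewrite (leq_trans (leq_maxr k0 M)) ?leq_addr.
have -> : block jK k.+1 = block j (K + k.+1)%N by rewrite /block /jK !addnS.
set r := (K + k.+1)%N.
pose s := [seq v <- iota 0 #|{: T r}| |
  `[< exists2 x, X x & enum_rank (tr r x) = v :> nat >]].
have sP v : v \in s -> exists2 x, X x & enum_rank (tr r x) = v :> nat.
  by rewrite mem_filter => /andP[/asboolP].
(* One representative per code suffices, as sets with equal codes have equal traces on the block. *)
have /choice[g gP] v : exists x, v \in s -> X x /\ enum_rank (tr r x) = v :> nat.
  have [vs|vs] := boolP (v \in s); last by exists set0.
  by have [x] := sP _ vs; exists x.
exists [set x `&` block j r | x in X]; split.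
- apply: (@card_le_seq_image _ _ (fun v => g v `&` block j r) s).
    apply: Xl => //; last by rewrite filter_uniq ?iota_uniq.
    by rewrite /r /K (leq_trans (leq_maxl k0 M)) ?leq_addr.
  move=> _ [x Xx <-]; exists (enum_rank (tr r x) : nat).
    rewrite /= mem_filter mem_iota /= add0n ltn_ord andbT.
    by apply/asboolP; exists x.
  have [|_] := gP (enum_rank (tr r x)).
    rewrite /= mem_filter mem_iota /= add0n ltn_ord andbT.
    by apply/asboolP; exists x.
  move=> /val_inj/enum_rank_inj e; apply/seteqP; split; apply: trP => //.
- by move=> _ [x Xx <-] p [_ []].
- move=> _ [x /XM xM <-]; apply: le_lt_trans (lt_trans xM _).
    by apply: submeasure_le => // p [].
  by rewrite lte_fin ltr_nat.
- by rewrite bigcup_image setI_bigcupl.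
Qed.

(** * Tukey maps into tail ideals *)

Section PiecesAndTukeyMaps.
Variables (R : realType) (w : nat -> nat -> R).
Hypothesis w_ge0 : forall m i, 0 <= w m i.

(** A set of codes below [e] is represented by the union of its pieces: each piece is small, but a
    set that is [small w 3] contains at most [l] of them. The threshold [2 ^- 3] lies below the
    weights 1/2 and 1/4 reached by the harmonic and the density pieces. *)
Definition pieces (e l k : nat) (p : nat -> set nat) :=
  [/\ forall v, exists n, p v `<=` `I_n,
      forall v, small w k (p v),
      forall v, p v `<=` ~` `I_k &
      forall s, uniq s -> (forall v, v \in s -> v < e)%N -> (l < size s)%N ->
        ~ small w 3 (\bigcup_(v in [set` s]) p v)].

(** A set [x] is sent to an initial segment recording a bound of [phi x], joined with the pieces of
    its codes. If [A] in the tail ideal contains all the images, the segments bound [phi] uniformly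
    on [X], and a small tail of [A] leaves room for at most [l k] codes at almost every level [k];
    [gradual_coding] then applies. *)
Lemma gradual_le_tail_ideal (phi : set nat -> \bar R) (l : nat -> nat) :
  submeasure phi -> lsc phi -> flat phi -> gradual phi ->
  (forall e k, exists p, pieces e (l k) k p) ->
  tukey_le (Fin phi) (tail_ideal w).
Proof.
move=> phi_sub phi_lsc phi_flat phi_gr pie.
(* Needed to bound the initial segments: unboundedly long ones would force [A] to be everything. *)
have notT n : ~ small w 3 (setT `\` `I_n).
  have [p [_ _ pn pbig]] := pie (l n).+1 n.
  move=> sT; apply: (pbig (iota 0 (l n).+1)); rewrite ?iota_uniq ?size_iota //.
    by move=> v; rewrite mem_iota.
  by apply: sub_small sT => // i [v _ /pn].
have [t [e [te tP]]] := gradual_coding l phi_sub phi_lsc phi_flat phi_gr.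
have /choice[p pP] k := pie (e k) k.
have /choice[mu muP] x : exists m : nat, Fin phi x -> (phi x < m%:R%:E)%E.
  have [Fx|nFx] := pselect (Fin phi x); last by exists 0%N.
  by have [m ?] := Fin_lt_nat phi_sub Fx; exists m.
apply/tukey_leP.
exists (fun x => `I_(mu x) `|` \bigcup_k p k (t k x)) => [x _|X XF].
  apply: tail_idealU => //; first exact: (finite_tail_ideal w_ge0 (n := mu x)).
  move=> k; have /choice[bd bdP] r : exists n, p r (t r x) `<=` `I_n.
    by have [] := pP r.
  exists (\max_(r < k.+1) bd r)%N.
  apply: (@sub_small _ _ w_ge0 _ _ (\bigcup_r p (k + r.+1)%N (t (k + r.+1)%N x))).
    move=> i [[r _ pi] /negP]; rewrite -leqNgt => bi.
    have [rk|kr] := leqP r k.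
      have := bdP r _ pi; rewrite /= ltnNge (leq_trans _ bi) //.
      by rewrite (leq_bigmax (Ordinal (rk : (r < k.+1)%N))).
    by exists (r - k.+1)%N => //; rewrite -subSn // subSS subnKC // ltnW.
  by apply: small_bigcup => // r; have [_] := pP (k + r.+1)%N.
move=> [A AJ fA]; apply/bounded_in_bigcup; first by move=> ? ?; apply: sub_Fin.
have {}fA x : X x -> `I_(mu x) `|` \bigcup_k p k (t k x) `<=` A.
  by move=> Xx; apply/subsetPset/fA; exists x.
have [n An] := AJ 3.
have [M MP] : exists M, forall x, X x -> (mu x <= M)%N.
  apply: contrapT => /forallNP unb; apply: (notT n).
  apply: sub_small An => // i [_ ni]; split=> //.
  have /existsNP[x /not_implyP[Xx /negP]] := unb i.
  by rewrite -ltnNge => ix; apply: (fA x) => //; left.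
apply: (tP M n) => [x Xx|k nk s s_uniq sX].
  apply: lt_le_trans (muP _ (XF _ Xx)) _.
  by rewrite lee_fin ler_nat; apply: MP.
rewrite leqNgt; apply/negP => ls.
have [_ _ pk pbig] := pP k; apply: (pbig s) => // [v /sX[x _ <-]//|].
apply: sub_small An => // i [v /sX[x Xx <-] pi]; split; last first.
  by have := pk _ _ pi; apply: contra_not => /= /leq_trans; apply.
by apply: (fA x) => //; right; exists k.
Qed.

End PiecesAndTukeyMaps.

(** * Disjoint pieces for the harmonic weights *)

Lemma wsumU_disjoint (R : realType) (w : nat -> nat -> R) m (a b : set nat) :
  a `&` b = set0 -> wsum w m (a `|` b) = wsum w m a + wsum w m b.
Proof.
move=> ab; rewrite /wsum (bigID (fun i : 'I_m => `[< a i >])) /=; congr (_ + _).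
  apply: eq_bigl => i; apply/andP/asboolP => [[_ /asboolP]//|ai].
  by split; apply/asboolP => //; left.
apply: eq_bigl => i; apply/andP/asboolP => [[/asboolP[|//] ai /asboolP//]|bi].
split; apply/asboolP; first by right.
by move=> ai; have : (a `&` b) i by []; rewrite ab.
Qed.

(** The piece starts the dyadic interval at [2 ^ (k + v)], so different [v] give disjoint pieces;
    its [2 ^ v] points weigh between [2 ^- k.+1] and [2 ^- k] in total. *)
Definition harmonic_piece k v : set nat :=
  [set i | (2 ^ (k + v) <= i < 2 ^ (k + v) + 2 ^ v)%N].

Lemma le_wsum_harmonic (R : realType) m n (a : set nat) : (m <= n)%N ->
  wsum (@harmonic_weight R) m a <= wsum (@harmonic_weight R) n a.
Proof.
move=> mn; rewrite /wsum -(big_mkord (fun i => `[< a i >]) (harmonic_weight R m)).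
rewrite -[leRHS](big_mkord (fun i => `[< a i >]) (harmonic_weight R n)).
rewrite [leRHS](big_cat_nat (n := m)) //= lerDl sumr_ge0 // => i _.
by rewrite invr_ge0.
Qed.

Lemma wsum_harmonic_interval (R : realType) m a b : (b <= m)%N ->
  wsum (@harmonic_weight R) m [set i | (a <= i < b)%N] =
  \sum_(a <= i < b) i.+1%:R^-1.
Proof.
move=> bm; rewrite (big_nat_widen _ _ m) // (big_nat_widenl _ 0) // big_mkord.
by apply: eq_bigl => i; apply/asboolP/idP; rewrite /= andbC.
Qed.

(** More than [2 ^ k] disjoint pieces of weight at least [2 ^- k.+1] weigh at least 1/2 together. *)
Lemma harmonic_pieces (R : realType) e k :
  exists p, pieces (@harmonic_weight R) e (2 ^ k) k p.
Proof.
have w0 m i : 0 <= harmonic_weight R m i by rewrite invr_ge0.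
exists (harmonic_piece k); split.
- by move=> v; exists (2 ^ (k + v) + 2 ^ v)%N => i /andP[].
- move=> v m; have mM := leq_maxl m (2 ^ (k + v) + 2 ^ v).
  apply: le_trans (le_wsum_harmonic _ _ mM) _.
  rewrite wsum_harmonic_interval ?leq_maxr //.
  apply: le_trans
    (_ : \sum_(2 ^ (k + v) <= i < 2 ^ (k + v) + 2 ^ v) 2 ^- (k + v) <= _).
    apply: ler_sum_nat => i /andP[ki _].
    rewrite -natrX lef_pV2 ?posrE ?ltr0n ?expn_gt0 //.
    by rewrite ler_nat ltnW.
  by rewrite sumr_const_nat addKn -[_ *+ (2 ^ v)]mulr_natr natrX exprD invfM mulfVK.
- move=> v i /= /andP[vi _]; apply/negP; rewrite -leqNgt.
  apply: leq_trans vi; apply: leq_trans (ltnW (ltn_expl k (ltnSn 1))) _.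
  by rewrite leq_exp2l // leq_addr.
move=> s s_uniq _ ls sm.
have piece_lt v : (2 ^ (k + v) + 2 ^ v <= 2 ^ (k + v).+1)%N.
  by rewrite expnS mul2n -addnn leq_add2l leq_exp2l // leq_addl.
have piece_disj v u i : harmonic_piece k v i -> harmonic_piece k u i -> (u <= v)%N.
  move=> /andP[_ iv] /andP[ui _].
  rewrite -(leq_add2l k) -ltnS -(ltn_exp2l _ _ (ltnSn 1)).
  by apply: leq_ltn_trans ui (leq_trans iv (piece_lt v)).
pose m := (\max_(v <- s) 2 ^ (k + v).+1)%N.
have : (size s)%:R * 2 ^- k.+1 <= wsum (@harmonic_weight R) m
    (\bigcup_(v in [set` s]) harmonic_piece k v).
  have : forall v, v \in s -> (2 ^ (k + v).+1 <= m)%N.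
    by move=> v vs; apply: (@leq_bigmax_seq _ s xpredT (fun v => 2 ^ (k + v).+1)%N).
  move: m; elim: s s_uniq {ls sm} => [_ m _|v s IH /= /andP[vs s_uniq] m sm].
    by rewrite mul0r; apply: sumr_ge0.
  rewrite (_ : \bigcup_(_ in _) _ = harmonic_piece k v `|`
    \bigcup_(u in [set` s]) harmonic_piece k u); last first.
    apply/seteqP; split=> [i [u /=]|i [vi|[u us ui]]].
    - by rewrite inE => /predU1P[-> ?|us ui]; [left|right; exists u].
    - by exists v; rewrite //= mem_head.
    - by exists u; rewrite //= inE us orbT.
  rewrite wsumU_disjoint; last first.
    apply/seteqP; split=> // i [vi [u us ui]].
    have uv : u = v by apply/eqP; rewrite eqn_leq !(piece_disj _ _ i).
    by rewrite -uv /= us in vs.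
  rewrite -natr1 mulrDl mul1r addrC lerD //; last first.
    by apply: IH => // u us; apply: sm; rewrite inE us orbT.
  rewrite wsum_harmonic_interval; last first.
    by apply: leq_trans (piece_lt v) (sm _ _); rewrite mem_head.
  apply: le_trans
    (_ : _ <= \sum_(2 ^ (k + v) <= i < 2 ^ (k + v) + 2 ^ v) 2 ^- (k + v).+1) _.
    rewrite sumr_const_nat addKn -[_ *+ (2 ^ v)]mulr_natr natrX -addSn.
    by rewrite exprD invfM mulfVK.
  apply: ler_sum_nat => i /andP[_ ki].
  rewrite -natrX lef_pV2 ?posrE ?ltr0n ?expn_gt0 //.
  by rewrite ler_nat; apply: leq_trans ki (piece_lt v).
move=> /le_trans /(_ (sm m)); apply/negP; rewrite -ltNge.
apply: (@lt_le_trans _ _ ((2 ^ k)%:R * 2 ^- k.+1)).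
  have -> : (2 ^ k)%:R * 2 ^- k.+1 = 2^-1 :> R.
    by rewrite natrX exprS invfM mulrCA divff ?mulr1 ?expf_neq0 ?pnatr_eq0.
  by rewrite -[X in _ < X^-1]expr1 ltf_pV2 ?posrE ?exprn_gt0 // ltr_eXn2l // ltr1n.
by rewrite ler_wpM2r ?invr_ge0 ?exprn_ge0 // ler_nat ltnW.
Qed.

(** * Independent pieces for the density weights *)

Definition density_block (D : finType) (Q : {pred D}) : set nat :=
  [set i | exists2 z, z \in Q & i = (#|D| + enum_rank z)%N].

Lemma density_block_ge (D : finType) (Q : {pred D}) :
  density_block Q `<=` ~` `I_#|D|.
Proof. by move=> _ [z _ ->] /=; apply/negP; rewrite -leqNgt leq_addr. Qed.

Lemma density_block_lt (D : finType) (Q : {pred D}) :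
  density_block Q `<=` `I_(#|D| + #|D|).
Proof. by move=> _ [z _ ->] /=; rewrite ltn_add2l ltn_ord. Qed.

Lemma finite_density_block (D : finType) (Q : {pred D}) :
  finite_set (density_block Q).
Proof. exact: sub_finite_set (@density_block_lt D Q) (finite_II _). Qed.

Lemma card_density_block (D : finType) (Q : {pred D}) :
  #|` fset_set (density_block Q)| = #|Q|.
Proof.
rewrite (_ : fset_set _ = [fset (#|D| + enum_rank z)%N | z in Q]%fset).
  rewrite card_imfset /= -?cardE // => z z' /addnI.
  exact/inj_comp/enum_rank_inj/val_inj.
apply/fsetP => i; rewrite in_fset_set; last exact: finite_density_block.
apply/idP/imfsetP => [|[z zQ ->]]; rewrite inE /=; last by exists z.
by case=> z ? ->; exists z.
Qed.

(** The block is placed in [[#|D|, 2 * #|D|)]: none of it is seen up to [#|D|], and afterwards at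
    most [#|Q|] points are divided by a larger number. *)
Lemma wsum_density_block (R : realType) (D : finType) (Q : {pred D}) m :
  wsum (@density_weight R) m (density_block Q) <= #|Q|%:R / #|D|%:R.
Proof.
rewrite wsum_density; have [mD|Dm] := leqP m #|D|.
  rewrite (_ : _ `&` _ = set0) ?fset_set0 ?mul0r ?divr_ge0 //.
  apply/seteqP; split=> // i [/density_block_ge + im]; apply.
  exact: leq_trans mD.
have [D0|D0] := posnP #|D|.
  have Q0 : #|Q| = 0%N by apply/eqP; rewrite -leqn0 -D0 max_card.
  rewrite (_ : density_block Q = set0) ?set0I ?fset_set0 ?mul0r ?divr_ge0 //.
  by apply/seteqP; split=> // i [z]; rewrite (card0_eq Q0).
have m0 : (0 < m)%N := ltn_trans D0 Dm.
rewrite ler_pdivrMr ?ltr0n // mulrAC ler_pdivlMr ?ltr0n // -!natrM ler_nat.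
rewrite leq_mul ?(ltnW Dm) //.
rewrite -card_density_block fsubset_leq_card // -fset_set_sub //.
- exact/finite_setIl/finite_density_block.
- exact: finite_density_block.
Qed.

Lemma wsum_density_block_double (R : realType) (D : finType) (Q : {pred D}) :
  wsum (@density_weight R) (#|D| + #|D|) (density_block Q) =
  #|Q|%:R / (#|D| + #|D|)%:R.
Proof.
rewrite wsum_density -card_density_block; congr (#|` fset_set _|%:R / _).
exact/setIidPl/density_block_lt.
Qed.

Lemma card_ffun_avoid (n q : nat) (T : {set 'I_n}) (c : 'I_q) :
  #|[pred z : {ffun 'I_n -> 'I_q} | [forall v in T, z v != c]]| =
  (q.-1 ^ #|T| * q ^ (n - #|T|))%N.
Proof.
pose F v := if v \in T then predC1 c else predT.
rewrite (@eq_card _ _ (family F)); last first.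
  move=> z; rewrite !inE; apply/forall_inP/familyP => zT v.
    by rewrite /F; case: ifP => // vT; rewrite !inE; apply: zT.
  by move=> vT; have := zT v; rewrite /F vT !inE.
rewrite card_family foldrE big_image /=.
rewrite (bigID (mem T)) /=; congr (_ * _)%N.
  rewrite (eq_bigr (fun=> q.-1)) ?prod_nat_const // => v vT.
  by rewrite /F vT cardC1 card_ord.
rewrite (eq_bigr (fun=> q)) => [|v /negbTE vT]; last by rewrite /F vT card_ord.
rewrite prod_nat_const; congr (_ ^ _)%N.
apply/eqP; rewrite -(eqn_add2l #|T|) subnKC ?cardC ?card_ord //.
by rewrite -[leqRHS]card_ord max_card.
Qed.

(** That is, $(1-1/q)^c\le 1/2$ for $c\ge q$; it follows from Bernoulli's inequality $(1+1/r)^n\ge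
    1+n/r$ with $r=q-1$ and $n=q$. *)
Lemma double_pow_pred q c : (0 < q <= c)%N -> (2 * q.-1 ^ c <= q ^ c)%N.
Proof.
case: q => // r /= rc.
have bern n : (r ^ n * (r + n) <= r * r.+1 ^ n)%N.
  elim: n => [|n IH]; first by rewrite !expn0 mul1n muln1 addn0.
  rewrite [in leqRHS]expnSr mulnA; apply: leq_trans (leq_mul IH (leqnn r.+1)).
  rewrite expnSr -!mulnA leq_mul2l; apply/orP; right.
  by rewrite addnS !mulnS [((r + n) * r)%N]mulnC leq_add2r leq_addr.
have base : (2 * r ^ r.+1 <= r.+1 ^ r.+1)%N.
  have [->|r0] := posnP r; first by rewrite exp0n // muln0.
  rewrite -(leq_pmul2l r0); apply: leq_trans (bern r.+1).
  rewrite mulnA mulnC leq_mul2l; apply/orP; right.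
  by rewrite mulnC mul2n -addnn leq_add2l leqnSn.
rewrite -(subnKC rc) !expnD mulnA leq_mul //.
by have [->//|n0] := posnP (c - r.+1)%N; rewrite leq_exp2r.
Qed.

(* The [v]-th piece consists of the functions vanishing at [v]: these are
   independent sets of density [2 ^- k]. *)
Lemma density_pieces (R : realType) e k :
  exists p, pieces (@density_weight R) e (2 ^ k) k p.
Proof.
have w0 m i : 0 <= density_weight R m i by rewrite invr_ge0.
have q0 : (0 < 2 ^ k)%N by rewrite expn_gt0.
set q := (2 ^ k)%N in q0 *; pose c : 'I_q := Ordinal q0.
(* The successor keeps the index type inhabited, as [inord] requires. *)
pose D := {ffun 'I_e.+1 -> 'I_q}.
have cardD : #|{: D}| = (q ^ e.+1)%N by rewrite card_ffun !card_ord.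
pose Q v := [pred z : D | z (inord v) == c].
have cardQ v : (#|Q v| * q = #|{: D}|)%N.
  have := card_ffun_avoid (finset.set1 (inord v : 'I_e.+1)) c.
  rewrite finset.cards1 expn1 subSS subn0 => cQ.
  have eQ : #|[predC Q v]| = (q.-1 * q ^ e)%N.
    rewrite -cQ; apply: eq_card => z; rewrite !inE.
    apply/idP/forall_inP => [zv u|/(_ (inord v))]; last by rewrite inE eqxx => ->.
    by rewrite inE => /eqP ->.
  have qE : (q * q ^ e = q ^ e + q.-1 * q ^ e)%N by rewrite -mulSn prednK.
  have := cardC (Q v); rewrite eQ cardD expnS qE => /addIn ->.
  by rewrite mulnC -mulSn prednK.
exists (fun v => density_block (Q v)); split.
- by move=> v; exists (#|{: D}| + #|{: D}|)%N; apply: density_block_lt.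
- move=> v m; apply: le_trans (wsum_density_block _ _ _) _.
  rewrite -(cardQ v) natrM invfM.
  have [->|Qv] := posnP #|Q v|; first by rewrite mul0r invr_ge0 exprn_ge0.
  by rewrite mulrA divff ?mul1r ?pnatr_eq0 ?lt0n_neq0 // /q natrX.
- move=> v; apply: subset_trans (@density_block_ge _ _) _.
  apply: subsetC => i /= /leq_trans; apply.
  rewrite cardD; apply: leq_trans (ltnW (ltn_expl k (ltnSn 1))) _.
  by rewrite -/q -[X in (X <= _)%N]expn1 leq_pexp2l.
move=> s s_uniq se ls sm.
pose T : {set 'I_e.+1} := finset (fun i : 'I_e.+1 => val i \in s).
have cardT : #|T| = size s.
  have inord_inj : {in s &, injective (@inord e)}.
    by move=> u v /se ue /se ve /(congr1 val); rewrite /= !inordK // ltnW.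
  rewrite cardsE -(size_map (@inord e)) -(card_uniqP _) ?map_inj_in_uniq //.
  apply: eq_card => i; rewrite -topredE /=; apply/idP/mapP => [|[v vs ->]].
    by exists (val i) => //; rewrite inord_val.
  by rewrite inordK // ltnS ltnW // se.
(* The union of the chosen pieces. Avoiding [c] on more than [q] points has probability at most 1/2,
   so [QT] is at least half of [D] and its block has density at least 1/4 at [2 * #|D|], above
   [2 ^- 3]. *)
pose QT := [pred z : D | ~~ [forall v in T, z v != c]].
have cardQT : (#|{: D}| <= 2 * #|QT|)%N.
  have := cardC QT; rewrite (_ : #|[predC QT]| = q.-1 ^ #|T| * q ^ (e.+1 - #|T|))%N.
    move=> DE; rewrite mul2n -addnn -{1}DE leq_add2l.
    rewrite -(leq_add2r (q.-1 ^ #|T| * q ^ (e.+1 - #|T|))) DE addnn -mul2n mulnA.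
    rewrite cardD -[X in (_ <= q ^ X)%N](subnKC (_ : #|T| <= e.+1)%N).
      by rewrite expnD leq_mul // double_pow_pred // q0 cardT ltnW.
    by rewrite -[leqRHS]card_ord max_card.
  by rewrite -(card_ffun_avoid T c); apply: eq_card => z; rewrite !inE negbK.
have := sm (#|{: D}| + #|{: D}|)%N.
rewrite (_ : \bigcup_(v in _) _ = density_block QT); last first.
  apply/seteqP; split=> [_ [v /= vs [z zQ ->]]|_ [z zQ ->]].
    have vT : inord v \in T by rewrite inE /= inordK // ltnS ltnW // se.
    exists z => //; rewrite inE; apply/negP => /forall_inP/(_ _ vT)/negP.
    by apply; move: zQ; rewrite inE.
  move: zQ; rewrite inE negb_forall_in => /exists_inP[v].
  rewrite inE negbK => vs zv.
  by exists (val v) => //; exists z => //; rewrite !inE inord_val.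
rewrite wsum_density_block_double.
have D0 : (0 < #|{: D}|)%N by rewrite cardD expn_gt0 q0.
rewrite ler_pdivrMr ?ltr0n ?addn_gt0 ?D0 // mulrC ler_pdivlMr ?exprn_gt0 //.
rewrite -natrX -natrM ler_nat addnn -mul2n => h.
have := leq_mul (leqnn 4) cardQT; rewrite mulnA [(_ * #|QT|)%N]mulnC.
by move=> /leq_trans/(_ h); rewrite leq_pmul2r.
Qed.

Lemma gradually_flat_le_Z0 (R : realType) (I : set (set nat)) :
  gradually_flat_ideal R I -> tukey_le I (Z0 R).
Proof.
move=> [phi [phi_sub phi_lsc phi_flat phi_gr ->]]; rewrite Z0_tail_ideal.
apply: (@gradual_le_tail_ideal _ _ _ _ (fun k => 2 ^ k)%N) => //.
  by move=> m i; rewrite invr_ge0.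
exact: density_pieces.
Qed.

Lemma gradually_flat_le_l1 (R : realType) (I : set (set nat)) :
  gradually_flat_ideal R I -> tukey_le I (l1 R).
Proof.
move=> [phi [phi_sub phi_lsc phi_flat phi_gr ->]]; rewrite l1_tail_ideal.
apply: (@gradual_le_tail_ideal _ _ _ _ (fun k => 2 ^ k)%N) => //.
  by move=> m i; rewrite invr_ge0.
exact: harmonic_pieces.
Qed.

(** * Flat submeasures that are not gradual *)

(** Graduality is refuted at the bound [n + 1]; lower semicontinuity then cuts the sets down to a
    finite interval, the union keeping submeasure above [n]. What matters is that [l] depends on [n]
    but not on [j]. *)
Lemma not_gradual_blocks (R : realType) (phi : set nat -> \bar R) :
  submeasure phi -> lsc phi -> ~ gradual phi ->
  exists2 M : R, 0 < M & forall n : nat, exists l : nat, forall j : nat,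
    exists (g : nat -> set nat) (q : nat),
      [/\ forall i, g i `<=` ~` `I_j, forall i, g i `<=` `I_q,
          forall i, (phi (g i) < M%:E)%E &
          (n%:R%:E <= phi (\bigcup_(i in `I_l) g i))%E].
Proof.
move=> phi_sub phi_lsc /existsNP[M /not_implyP[M0 /forallPNP nogr]].
exists M => // n.
have /existsNP[l /forallNP lP] := nogr n.+1%:R (ltr0Sn R n).
exists l => j; have /existsNP[B] := lP j.
move=> /not_implyP[/pcard_leP/unsquash f] /not_implyP[Bj] /not_implyP[BM].
move=> /negP; rewrite -leNgt => phiB.
(* [B] is listed through its injection [f] into [I_l]; indices outside the image get the empty
   set. *)
have /choice[g0 gP] i : exists b, (B b /\ f b = i) \/
    (b = set0 /\ forall b, B b -> f b <> i).
  have [[b]|nb] := pselect (exists b, B b /\ f b = i); first by exists b; left.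
  by exists set0; right; split=> // b Bb fb; apply: nb; exists b.
have Bg : \bigcup_(b in B) b = \bigcup_(i in `I_l) g0 i.
  apply/seteqP; split=> p [].
    move=> b Bb bp; exists (f b); first exact: funS.
    have [[Bg fg]|[_ /(_ b Bb)//]] := gP (f b).
    by rewrite (_ : g0 (f b) = b) //; apply: (inj (f := f)); rewrite ?inE.
  move=> i _ gp; have [[Bg _]|[g0E _]] := gP i; first by exists (g0 i).
  by rewrite g0E in gp.
have [q qP] : exists q, (n%:R%:E < phi (\bigcup_(b in B) b `&` `I_q))%E.
  by apply: lsc_gt => //; apply: lt_le_trans phiB; rewrite lte_fin ltr_nat.
exists (fun i => g0 i `&` `I_q), q; split=> [i|i|i|].
- have [[/Bj gj _]|[-> _]] := gP i; first by move=> p [/gj].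
  by move=> p [].
- by move=> p [].
- apply: le_lt_trans (submeasure_le phi_sub (@subIsetl _ _ _)) _.
  have [[/BM//]|[-> _]] := gP i.
  by rewrite (submeasure0 phi_sub) lte_fin.
- by rewrite -setI_bigcupl -Bg ltW.
Qed.

Lemma separating_prefixes (a : nat -> nat -> bool) l : injective a ->
  exists m, forall i j, (i < l)%N -> (j < l)%N ->
    mkseq (a i) m = mkseq (a j) m -> i = j.
Proof.
move=> a_inj.
have /choice[D DP] (ij : nat * nat) : exists p, ij.1 <> ij.2 ->
    a ij.1 p <> a ij.2 p.
  have [->|ne] := pselect (ij.1 = ij.2); first by exists 0%N.
  have [p np] : exists p, a ij.1 p <> a ij.2 p; last by exists p.
  by apply/existsNP => eqa; apply/ne/a_inj/funext.
exists (\max_(i < l) \max_(j < l) D (i : nat, j : nat)).+1 => i j il jl.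
move=> e; apply: contrapT => /(DP (i, j)); apply.
have := congr1 (fun s => nth false s (D (i, j))) e.
rewrite !nth_mkseq // ltnS.
  apply: leq_trans (leq_bigmax (Ordinal il)) => /=.
  exact: (leq_bigmax (Ordinal jl)).
apply: leq_trans (leq_bigmax (Ordinal il)) => /=.
exact: (leq_bigmax (Ordinal jl)).
Qed.

(** The choice made by [c] in a block with word list [s]. Without a prefix of [c] in [s] the value
    is [size s], which is harmless since the sets [g i] are bounded for every index [i]. *)
Definition prefix_index (s : seq (seq bool)) (c : nat -> bool) : nat :=
  find (fun u => u == mkseq c (size u)) s.

Lemma prefix_indexE (a : nat -> nat -> bool) l m :
  (forall i j, (i < l)%N -> (j < l)%N ->
    mkseq (a i) m = mkseq (a j) m -> i = j) ->
  forall i, (i < l)%N ->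
    prefix_index [seq mkseq (a r) m | r <- iota 0 l] (a i) = i.
Proof.
move=> sep i il; rewrite /prefix_index find_map; set P := preim _ _.
have hasP : has P (iota 0 l).
  by apply/hasP; exists i; rewrite ?mem_iota //= size_mkseq.
have fl : (find P (iota 0 l) < l)%N.
  by rewrite -[X in (_ < X)%N](size_iota 0) -has_find.
have := nth_find 0%N hasP; rewrite nth_iota // add0n /= size_mkseq => /eqP.
exact: sep.
Qed.

(* Every block encodes a number [n] and a finite list of binary words; the
   members of an infinite family select, in a block whose list separates enough
   of them, all of the sets whose union has submeasure at least [n]. *)
Lemma not_gradual_ge_fin_continuum (R : realType) (phi : set nat -> \bar R) :
  submeasure phi -> lsc phi -> flat phi -> ~ gradual phi ->
  tukey_le fin_continuum (Fin phi).
Proof.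
move=> phi_sub phi_lsc phi_flat /(not_gradual_blocks phi_sub phi_lsc)[M M0].
move=> /choice[l lP].
have /choice[g gP] (nj : nat * nat) := lP nj.1 nj.2.
have {gP}/choice[q gP] := gP.
have [N N0 [J JP]] := flat_uniform phi_flat M0.
pose dec r : nat * seq (seq bool) := odflt (0%N, [::]) (choice.unpickle r).
(* Block [r] lies between [J (Q r)] and [Q r.+1], the gap from [Q r] to [J (Q r)] being the one that
   flatness needs. *)
pose Q := fix Q r := if r is r'.+1 then
  maxn (Q r') (q ((dec r').1, J (Q r'))) else 0%N.
pose b c r := g ((dec r).1, J (Q r)) (prefix_index (dec r).2 c).
pose x c := \bigcup_r b c r.
have xF c : Fin phi (x c).
  apply: le_lt_trans (ltry N).
  apply: (flat_blocks phi_sub phi_lsc (q := Q)) N0 JP _ _ _ _ => r.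
  - exact: leq_maxl.
  - have [_ + _ _] := gP ((dec r).1, J (Q r)) => gq p /gq /= pq.
    by apply: leq_trans pq (leq_maxr _ _).
  - by have [+ _ _ _] := gP ((dec r).1, J (Q r)); apply.
  - by have [_ _ + _] := gP ((dec r).1, J (Q r)); apply.
apply/tukey_leP; exists (fun F => \bigcup_(c in F) x c) => [F Ff|X _].
  rewrite -(bigcup_image F x id); apply: Fin_bigcup_finite => //.
    exact: finite_image.
  by move=> _ [c _ <-].
move=> [A AF uA]; apply/bounded_in_fin_continuum.
have {}uA F c : X F -> F c -> x c `<=` A.
  move=> XF Fc; apply: subset_trans (_ : \bigcup_(c in F) x c `<=` A).
    exact: bigcup_sup.
  by apply/subsetPset/uA; exists F.
apply: contrapT => /infiniteP/pcard_leP/unsquash a.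
have a_inj : injective a by move=> i j; apply: (inj (f := a)); rewrite inE.
have aA i : x (a i) `<=` A.
  by have [F XF Fa] : (\bigcup_(F in X) F) (a i); [exact: funS|exact: uA Fa].
have [n] := Fin_lt_nat phi_sub AF.
apply/negP; rewrite -leNgt.
have [m sep] := separating_prefixes (l n) a_inj.
(* In the block coding [(n, s)] the point [a i] selects the [i]-th set, so the first [l n] points
   select them all. *)
pose s := [seq mkseq (a i) m | i <- iota 0 (l n)].
pose r := choice.pickle (n, s).
have decr : dec r = (n, s) by rewrite /dec choice.pickleK.
have [_ _ _ /le_trans] := gP (n, J (Q r)); apply.
apply: (submeasure_le phi_sub) => p [i il gp]; apply: (aA i); exists r => //.
by rewrite /b decr /= (prefix_indexE sep).
Qed.

(** Singletons of distinct points are bounded together only if there are finitely many of them, and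
    finite families are bounded in any ideal; characteristic functions thus give a Tukey map. *)
Lemma fin_continuum_ge_Fin (R : realType) (phi : set nat -> \bar R) :
  submeasure phi -> tukey_le (Fin phi) fin_continuum.
Proof.
move=> phi_sub; pose c (x : set nat) n := `[< x n >].
apply/tukey_leP; exists (fun x => [set c x]) => [x _|X XF].
  exact: finite_set1.
have c_inj : injective c.
  move=> x y e; apply/seteqP; split=> n; move: (congr1 (@^~ n) e) => /= en xn;
    by apply/asboolP; move/asboolP: xn; rewrite ?/c in en *; rewrite en.
move=> /bounded_in_fin_continuum; rewrite bigcup_image => fX.
apply/bounded_in_bigcup; first by move=> ? ?; apply: sub_Fin.
apply: Fin_bigcup_finite => //.
have := finite_preimage (f := c) (in2W c_inj) fX.
by apply: sub_finite_set => x Xx; exists x.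
Qed.

(** The same argument with codes of graphs; finitely many functions are bounded by their pointwise
    maximum. *)
Lemma baire_le_fin_continuum : tukey_le baire fin_continuum.
Proof.
pose c (f : nat -> nat) n :=
  if choice.unpickle n is Some (i, j) then f i == j else false.
have c_inj : injective c.
  move=> f g e; apply/funext => i; have := congr1 (@^~ (choice.pickle (i, f i))) e.
  by rewrite /c choice.pickleK eqxx => /esym/eqP.
apply/tukey_leP; exists (fun f => [set c f]) => [f _|X _].
  exact: finite_set1.
move=> /bounded_in_fin_continuum; rewrite bigcup_image => fX.
have /finite_seqP[s Xs] : finite_set X.
  have := finite_preimage (f := c) (in2W c_inj) fX.
  by apply: sub_finite_set => f Xf; exists f.
exists (fun i => \max_(f <- s) f i)%N => // f; rewrite Xs => /= fs.
by apply/lefP => i; apply: (@leq_bigmax_seq _ s xpredT (fun f => f i)).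
Qed.

Lemma not_equiv_fin_continuum_gradually_flat (R : realType)
    (I : set (set nat)) :
  flat_ideal R I -> ~ tukey_equiv I fin_continuum -> gradually_flat_ideal R I.
Proof.
move=> [phi [phi_sub phi_lsc phi_flat ->]] neq; exists phi; split=> //.
apply: contrapT => ngr; apply: neq; split; first exact: fin_continuum_ge_Fin.
exact: not_gradual_ge_fin_continuum.
Qed.

(** * The game *)

Definition last_family (I : set (set nat)) (h : seq moveII) : set (set nat) :=
  last I [seq mvU m | m <- h].

Lemma last_family_mkseq (I : set (set nat)) (r : nat -> moveII) n :
  last_family I (mkseq r n) = prevU I r n.
Proof.
by case: n => // n; rewrite /last_family mkseqS map_rcons last_rcons.
Qed.

(** In round [n] Player I partitions by the code [t n] and covers by bounds on [phi], then thins the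
    sequence so that its code at level [k] is constant from the [k]-th term on. The first round
    fixes a common bound of [phi]. *)
Lemma gradually_flat_Fremlin (R : realType) (I : set (set nat)) :
  gradually_flat_ideal R I -> Fremlin I.
Proof.
move=> [phi [phi_sub phi_lsc phi_flat phi_gr ->]].
have [t [e [te tP]]] := gradual_coding (fun k => k.+1 * k.+1)%N
  phi_sub phi_lsc phi_flat phi_gr.
have /choice[a aP] (x : nat -> set nat) : exists a : nat -> nat,
    injective a /\ forall k i, (k <= i)%N -> t k (x (a i)) = t k (x (a k)).
  have [a a1 a2] := convergent_subsequence (fun k i => te k (x i)).
  by exists a.
pose cell h (Mv : nat * nat) := [set x | [/\ last_family (Fin phi) h x,
  (phi x < Mv.1%:R%:E)%E & t (size h) x = Mv.2]].
pose s := StrategyI (fun h => range (cell h)) (fun _ _ x => range (a x)).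
have step r k : legalII s r k -> exists Mv : nat * nat, mvU (r k) =
    [set x | [/\ prevU (Fin phi) r k x, (phi x < Mv.1%:R%:E)%E & t k x = Mv.2]].
  by move=> [[Mv _ <-] _]; exists Mv; rewrite /cell last_family_mkseq size_mkseq.
have stepS r k : legalII s r k -> mvU (r k) `<=` prevU (Fin phi) r k.
  by move=> /step[Mv ->] x [].
have prevF r n : (forall k, (k < n)%N -> legalII s r k) ->
    prevU (Fin phi) r n `<=` Fin phi.
  elim: n => [_ //|n IH leg x]; move=> /(stepS _ _ (leg n (ltnSn n))).
  by apply: IH => k kn; apply: leg; apply: ltnW.
exists s; split.
  move=> r n leg; split.
  - exact: sub_countable (card_image_le _ _) (countableP _).
  - rewrite /famI /=; apply/seteqP; split=> [x [_ [Mv _ <-]]|x xn].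
      by case; rewrite last_family_mkseq.
    have [M xM] := Fin_lt_nat phi_sub (prevF _ _ leg _ xn).
    exists (cell (mkseq r n) (M, t n x)); first by exists (M, t n x).
    by split; rewrite ?last_family_mkseq ?size_mkseq.
  - by move=> _; apply: infinite_range; have [] := aP (mvx (r n)).
move=> r leg.
have mono k n : (k <= n)%N -> mvU (r n) `<=` mvU (r k).
  elim: n => [|n IH]; first by rewrite leqn0 => /eqP ->.
  rewrite leq_eqVlt => /predU1P[->//|]; rewrite ltnS => /IH; apply: subset_trans.
  exact: (stepS _ n.+1).
pose y n i := mvx (r n) (a (mvx (r n)) i).
have yU n i : mvU (r n) (y n i) by have [_] := leg n; apply.
have [[M v] U0] := step _ _ (leg 0%N).
apply: (sub_Fin phi_sub (b := \bigcup_(x in [set y ni.1 ni.2 | ni in setT]) x)).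
  move=> p [n _ [_ [[i _ <-] _] xp]].
  by exists (y n i) => //; exists (n, i).
apply: (tP M 0%N) => [_ [[n i] _ <-]|k _ u u_uniq uy].
  by have := mono 0%N n isT _ (yU n i); rewrite U0 => -[].
(* All codes at level [k] occur here: rounds after [k] stay in [mvU (r k)], where [t k] is constant,
   and in earlier rounds [i] may be replaced by [minn i k]. *)
pose L := [seq t k (y n i) | n <- iota 0 k.+1, i <- iota 0 k.+1].
have <- : size L = (k.+1 * k.+1)%N by rewrite size_allpairs !size_iota.
apply: (uniq_leq_size u_uniq) => _ /uy[_ [[n i] _ <-] <-] /=.
have [nk|kn] := leqP n k; last first.
  apply/allpairsP; exists (k, 0%N); split; rewrite ?mem_iota //=.
  have [Mv Uk] := step _ _ (leg k).
  have : mvU (r k) (y n i) by apply: mono (ltnW kn) _ (yU n i).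
  by have := yU k 0%N; rewrite Uk => -[_ _ ->] [_ _ ->].
apply/allpairsP; exists (n, minn i k).
split; rewrite ?mem_iota /= ?add0n ?ltnS ?geq_minr //.
have [//|ki] := leqP i k.
by have [_] := aP (mvx (r n)); apply; apply: ltnW.
Qed.

(** Membership of [U] in the sigma-ideal generated by the families weakly bounded in [I]; unlike
    [sigma_weakly_bounded] it makes sense for the subfamilies arising in the game. *)
Definition sigma_covered (I U : set (set nat)) :=
  exists C : set (set (set nat)), [/\ countable C,
    forall W, C W -> weakly_bounded I W & U `<=` \bigcup_(W in C) W].

(** Used contrapositively: when Player I splits a family that is not covered, some part is again not
    covered. *)
Lemma sigma_covered_bigcup (I : set (set nat)) (F : set (set (set nat))) :
  countable F -> (forall V, F V -> sigma_covered I V) ->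
  sigma_covered I (\bigcup_(V in F) V).
Proof.
move=> cF FP.
have /choice[C CP] V : exists C : set (set (set nat)), F V -> [/\ countable C,
    forall W, C W -> weakly_bounded I W & V `<=` \bigcup_(W in C) W].
  have [FV|nFV] := pselect (F V); last by exists set0.
  by have [C ?] := FP _ FV; exists C.
exists (\bigcup_(V in F) C V); split.
- by apply: bigcup_countable => // V /CP[].
- by move=> W [V /CP[_ + _] CW]; apply.
- move=> x [V FV Vx]; have [_ _ /(_ x Vx)[W CW Wx]] := CP V FV.
  by exists W => //; exists V.
Qed.

Lemma weakly_bounded0 (I : set (set nat)) : weakly_bounded I set0.
Proof. by split=> // Y Y0 /infinite_setN0[y /Y0]. Qed.

Lemma sigma_coveredP (I : set (set nat)) :
  sigma_covered I I -> sigma_weakly_bounded I.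
Proof.
move=> [C [/countable_injP[g g_inj] CI IC]].
pose X n := \bigcup_(W in C `&` g @^-1` [set n]) W.
have XC n : weakly_bounded I (X n).
  have [[W [CW gW]]|nW] := pselect (exists W, C W /\ g W = n).
    suff -> : X n = W by apply: CI.
    apply/seteqP; split=> [x [V [CV /= gV] Vx]|x Wx]; last by exists W.
    by rewrite -(g_inj V W) ?inE // gV gW.
  suff -> : X n = set0 by apply: weakly_bounded0.
  by apply/seteqP; split=> // x [V [CV gV] _]; apply: nW; exists V.
exists X; split=> //; apply/seteqP; split=> [x /IC[W CW Wx]|x [n _ Xx]].
  by exists (g W) => //; exists W.
by have [+ _] := XC n; apply.
Qed.

(** [U] is not weakly bounded, so it contains an infinite set without infinite bounded subsets,
    listed by [x]. The union over any infinite [A] then has infinite submeasure, and finitely many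
    terms exceed [n]. *)
Lemma not_sigma_covered_unbounded (R : realType) (phi : set nat -> \bar R)
    (U : set (set nat)) :
  submeasure phi -> lsc phi -> U `<=` Fin phi -> ~ sigma_covered (Fin phi) U ->
  exists2 x : nat -> set nat, forall i, U (x i) &
    forall (A : set nat) (n : nat), infinite_set A ->
      exists m : nat, (n%:R%:E <= phi (\bigcup_(i in A `&` `I_m) x i))%E.
Proof.
move=> phi_sub phi_lsc UF ncov.
have : ~ weakly_bounded (Fin phi) U.
  move=> wbU; apply: ncov; exists [set U]; split=> [|_ ->//|x Ux].
    exact: countable1.
  by exists U.
move=> /not_andP[//|/existsNP[Y /not_implyP[YU /not_implyP[Yinf /forallNP Yun]]]].
have /infiniteP/pcard_leP/unsquash x := Yinf.
have x_inj : injective x by move=> i j; apply: (inj (f := x)); rewrite inE.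
have xY i : Y (x i) by exact: funS.
exists x => [i|A n Ainf]; first exact: YU.
have : (n%:R%:E < phi (\bigcup_(i in A) x i))%E.
  rewrite ltNge; apply/negP => phin; apply: (Yun (x @` A)); split.
  - by move=> _ [i _ <-].
  - move=> /(finite_preimage (in2W x_inj)); apply: contra_not Ainf.
    by apply: sub_finite_set => i Ai; exists i.
  - exists (\bigcup_(i in A) x i); first exact: le_lt_trans phin (ltry _).
    by move=> _ [i Ai <-]; apply/subsetPset/bigcup_sup.
move=> /(lsc_gt phi_lsc)[p pP].
have [m mP] := bigcup_initial_segment (fun i => [set q | A i /\ x i q]) p.
exists m; apply: le_trans (ltW pP) (submeasure_le phi_sub _) => q [[i Ai xq] qp].
have [|j jm [Aj xj]] := mP q; last by exists j.
by split=> //; exists i.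
Qed.

(* In a family that is not sigma-weakly bounded, Player II can always force
   the next [b_n] to have submeasure at least [n]. *)
Lemma Fremlin_sigma_weakly_bounded (R : realType) (phi : set nat -> \bar R) :
  submeasure phi -> lsc phi -> Fremlin (Fin phi) ->
  sigma_weakly_bounded (Fin phi).
Proof.
move=> phi_sub phi_lsc [s [s_legal s_win]]; apply/sigma_coveredP.
apply: contrapT => ncov.
pose I := Fin phi.
(* Player II's answer as a function of the history; it is constrained only where the current family
   is not covered and Player I's move obeys the rules. *)
have /choice[nx nxP] h : exists mv : moveII,
    ~ sigma_covered I (last_family I h) -> last_family I h `<=` I ->
    countable (playU s h) -> \bigcup_(U in playU s h) U = last_family I h ->
    [/\ playU s h (mvU mv), ~ sigma_covered I (mvU mv),
        forall i, mvU mv (mvx mv i) &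
        infinite_set (playA s h (mvU mv) (mvx mv)) ->
        ((size h)%:R%:E <= phi (\bigcup_(i in playA s h (mvU mv) (mvx mv)
            `&` `I_(mvm mv)) mvx mv i))%E].
  have [[nc [hI [ch Uh]]]|no] := pselect (~ sigma_covered I (last_family I h) /\
      last_family I h `<=` I /\
      countable (playU s h) /\ \bigcup_(U in playU s h) U = last_family I h);
    last by exists (MoveII set0 (fun=> set0) 0) => ? ? ? ?; case: no.
  have [U [hU ncU]] : exists U, playU s h U /\ ~ sigma_covered I U.
    apply: contrapT => /forallNP noU; apply: nc; rewrite -Uh.
    apply: sigma_covered_bigcup => // V hV.
    by apply: contrapT => ncV; apply: (noU V).
  have UI : U `<=` I.
    by apply: subset_trans hI; rewrite -Uh; apply: bigcup_sup.
  have [x xU xP] := not_sigma_covered_unbounded phi_sub phi_lsc UI ncU.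
  have [Ainf|Afin] := pselect (infinite_set (playA s h U x)).
    by have [m mP] := xP _ (size h) Ainf; exists (MoveII U x m).
  (* The last requirement is vacuous here, so [0] is a mere default. *)
  by exists (MoveII U x 0).
pose hist := fix hist n := if n is n'.+1 then rcons (hist n') (nx (hist n'))
  else [::].
pose r n := nx (hist n).
have histE n : hist n = mkseq r n.
  by elim: n => // n IH; rewrite mkseqS -IH.
have inv n : [/\ forall k, (k < n)%N -> legalII s r k,
    ~ sigma_covered I (prevU I r n) & prevU I r n `<=` I].
  elim: n => [|n [leg nc nI]]; first by split.
  have [cf Uf infA] := s_legal r n leg.
  have := nxP (mkseq r n); rewrite last_family_mkseq => /(_ nc nI cf Uf).
  rewrite -histE -/(r n) => -[rU rnc rx _].
  have legn : legalII s r n by split=> //; rewrite /famI -histE.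
  split=> //= [k|].
    by rewrite ltnS leq_eqVlt => /predU1P[->|/leg].
  move=> x Ux; apply: nI; rewrite -Uf; exists (mvU (r n)) => //.
  by case: legn.
have leg n : legalII s r n by have [+ _ _] := inv n.+1; apply.
have [n] := Fin_lt_nat phi_sub (s_win r leg).
apply/negP; rewrite -leNgt.
have [legn nc nI] := inv n; have [cf Uf infA] := s_legal r n legn.
have := nxP (mkseq r n); rewrite last_family_mkseq => /(_ nc nI cf Uf)[_ _ _].
rewrite -histE -/(r n) histE size_mkseq => /(_ (infA (leg n)))/le_trans; apply.
by apply: (submeasure_le phi_sub) => p op; exists n.
Qed.

(** Under a Tukey map, the functions sent into one weakly bounded [X n] are bounded at every
    coordinate. A function exceeding the [n]-th bound at coordinate [n] is therefore sent into no
    [X n]. *)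
Lemma sigma_weakly_bounded_not_ge_baire (R : realType)
    (phi : set nat -> \bar R) :
  submeasure phi -> sigma_weakly_bounded (Fin phi) ->
  ~ tukey_le baire (Fin phi).
Proof.
move=> phi_sub [X [FX Xwb]] /tukey_leP[f fF fb].
have bnd n k : exists b, forall g : nat -> nat, X n (f g) -> (g k <= b)%N.
  apply: contrapT => /forallNP unb.
  have /choice[g gP] i : exists g : nat -> nat, X n (f g) /\ (i < g k)%N.
    have /existsNP[g /not_implyP[Xg /negP]] := unb i.
    by rewrite -ltnNge; exists g.
  have fgF i : Fin phi (f (g i)) by apply: fF.
  (* A bound [u] of infinitely many [g i] is absurd, because [i < g i k <= u k]. *)
  suff [Z Zinf [u _ uZ]] : exists2 Z : set nat, infinite_set Z &
      bounded_in baire (g @` Z).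
    apply: Zinf; apply: sub_finite_set (finite_II (u k)) => i Zi /=.
    have /lefP/(_ k) : (g i <= u)%O by apply: uZ; exists i.
    by apply: leq_trans; have [] := gP i.
  (* Weak boundedness concerns infinite sets of values only; with finitely many values all the [g i]
     are bounded together. *)
  have [fin|inf] := pselect (finite_set (range (f \o g))).
    exists setT; first exact: infinite_nat.
    apply: fb => //; apply/bounded_in_bigcup; first by move=> ? ?; apply: sub_Fin.
    rewrite image_comp; apply: Fin_bigcup_finite => //.
    by move=> _ [i _ <-]; apply: fgF.
  have [_ /(_ (range (f \o g)))] := Xwb n.
  have sub : range (f \o g) `<=` X n by move=> _ [i _ <-]; have [] := gP i.
  move=> /(_ sub inf)[Z [Zr Zinf [u Fu uZ]]].
  exists ((f \o g) @^-1` Z).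
    move=> /(finite_image (f \o g)); apply: contra_not Zinf.
    apply: sub_finite_set => z Zz; have [i _ iz] := Zr _ Zz.
    by exists i => //; move: Zz; rewrite -iz.
  apply: fb => //; exists u => // _ [_ [i Zi <-] <-].
  exact: uZ.
have /choice[b bP] (nk : nat * nat) := bnd nk.1 nk.2.
pose g n := (b (n, n)).+1.
have : Fin phi (f g) by apply: fF.
rewrite FX => -[n _ Xg].
by have := bP (n, n) g Xg; rewrite /= ltnn.
Qed.

(** * The cycle of implications *)

Lemma fin_continuum_not_le_Z0 (R : realType) : ~ tukey_le fin_continuum (Z0 R).
Proof.
rewrite Z0_tail_ideal; apply: fin_continuum_not_le_tail_ideal => m i.
by rewrite invr_ge0.
Qed.

Lemma fin_continuum_not_le_l1 (R : realType) : ~ tukey_le fin_continuum (l1 R).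
Proof.
rewrite l1_tail_ideal; apply: fin_continuum_not_le_tail_ideal => m i.
by rewrite invr_ge0.
Qed.

Theorem theorem5p1 (R : realType) (I : set (set nat))
    (flatI : flat_ideal R I) :
  [<-> gradually_flat_ideal R I;
       tukey_le I (Z0 R);
       tukey_le I (l1 R);
       ~ tukey_equiv I fin_continuum;
       Fremlin I;
       sigma_weakly_bounded I;
       ~ tukey_le baire I].
Proof.
(* The way back to gradual flatness, taken in the implications from (ii) to (iii), from (iv) to (v)
   and from (vii) to (i). *)
have gradI := not_equiv_fin_continuum_gradually_flat flatI.
have [phi [phi_sub phi_lsc _ IE]] := flatI.
tfae.
- exact: gradually_flat_le_Z0.
- move=> IZ; apply/gradually_flat_le_l1/gradI => -[_ cI].
  exact: fin_continuum_not_le_Z0 (tukey_le_trans cI IZ).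
- move=> Il [_ cI]; exact: fin_continuum_not_le_l1 (tukey_le_trans cI Il).
- by move=> /gradI/gradually_flat_Fremlin.
- by rewrite IE; apply: Fremlin_sigma_weakly_bounded.
- by rewrite IE; apply: sigma_weakly_bounded_not_ge_baire.
- move=> nbI; apply: gradI => -[_ cI]; apply: nbI.
  exact: tukey_le_trans baire_le_fin_continuum cI.
Qed.
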